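(* There exists a Cantor set in $\mathbb{C}^2$ that has nontrivial rational hull and is the union of two polynomially convex Cantor sets.
   Context: A Cantor set is any space homeomorphic to the usual middle-thirds Cantor set. For a compact set $X\subset\mathbb{C}^N$, the polynomial hull is $\widehat X=\{z\in\mathbb{C}^N:|p(z)|\le\max_{x\in X}|p(x)|\text{ for all polynomials }p\}$ and the rational hull is $h_r(X)=\{z\in\mathbb{C}^N:p(z)\in p(X)\text{ for all polynomials }p\}$, where polynomials are in the complex coordinates. $X$ is polynomially convex if $\widehat X=X$; the rational hull of $X$ is nontrivial if $h_r(X)\setminus X\neq\emptyset$. *)

(* Defs.v *)
From HB Require Import structures.
From mathcomp Require Import all_boot all_order all_algebra.
From mathcomp Require Import all_classical all_reals all_analysis.
From mathcomp Require Import complex.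
(* [mpoly] is not imported: its notations clash with those of
   mathcomp-analysis. *)
From mathcomp Require mpoly.
Set Implicit Arguments.
Unset Strict Implicit.
Unset Printing Implicit Defensive.
Import Order.TTheory GRing.Theory Num.Theory.
Import numFieldNormedType.Exports.
Local Open Scope classical_set_scope.
Local Open Scope ring_scope.

(* The topology of [R[i]] is the one given by its norm; mathcomp-analysis
   provides it only on abstract number fields and on the alias [R[i]^o]. *)
HB.instance Definition _ (R : realType) := PseudoPointedMetric.copy R[i] R[i]^o.
HB.instance Definition _ (R : realType) := NormedModule.copy R[i] R[i]^o.

Definition homeomorphic (T U : topologicalType) (A : set T) (B : set U) : Prop :=
  exists (f : T -> U) (g : U -> T),
    [/\ {within A, continuous f}, {within B, continuous g},
        set_fun A B f /\ set_fun B A g,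
        {in A, cancel f g} & {in B, cancel g f}].

Section CantorSet.
Variable R : realType.

(* Removing the open middle third of every interval of stage [n] amounts to
   placing two copies of stage [n], scaled by 1/3, at the ends of [0, 1]. *)
Fixpoint middle_thirds_stage (n : nat) : set R :=
  match n with
  | 0 => `[0, 1]
  | n'.+1 => [set x / 3 | x in middle_thirds_stage n'] `|`
             [set (x + 2) / 3 | x in middle_thirds_stage n']
  end.

Definition middle_thirds : set R :=
  \bigcap_(n in [set: nat]) middle_thirds_stage n.

Definition is_Cantor_set (T : topologicalType) (X : set T) : Prop :=
  homeomorphic X middle_thirds.

End CantorSet.

Section Hulls.
Variables (R : realType) (N : nat).

(* C^N is ['rV[R[i]]_N], whose topology is the product topology. *)
Definition poly_eval (p : mpoly.mpoly N R[i]) (z : 'rV[R[i]]_N) : R[i] :=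
  mpoly.meval (fun j => z 0 j) p.

(* The norm of [R[i]] takes values in [R[i]]; this is its value in [R]. *)
Definition modulus (w : R[i]) : R := complex.Re `|w|.

(* For compact nonempty [X] the supremum is attained, hence a maximum; since
   [sup set0 = 0], the hull of the empty set is empty. *)
Definition polynomial_hull (X : set 'rV[R[i]]_N) : set 'rV[R[i]]_N :=
  [set z | forall p : mpoly.mpoly N R[i],
     modulus (poly_eval p z) <= sup [set modulus (poly_eval p x) | x in X]].

Definition rational_hull (X : set 'rV[R[i]]_N) : set 'rV[R[i]]_N :=
  [set z | forall p : mpoly.mpoly N R[i],
     (poly_eval p @` X) (poly_eval p z)].

Definition polynomially_convex (X : set 'rV[R[i]]_N) : Prop :=
  polynomial_hull X = X.

Definition nontrivial_rational_hull (X : set 'rV[R[i]]_N) : Prop :=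
  rational_hull X `\` X !=set0.

End Hulls.

(* Main.v *)
From HB Require Import structures.
Require Import Defs.
From mathcomp Require Import all_boot all_order all_algebra.
From mathcomp Require Import all_classical all_reals all_analysis.
From mathcomp Require Import complex finmap.
From mathcomp Require mpoly.
Import (canonicals, coercions) mpoly.
From mathcomp Require Import ring lra.
Import Order.TTheory GRing.Theory Num.Theory.
Import numFieldNormedType.Exports.
Local Open Scope classical_set_scope.
Local Open Scope ring_scope.

Set Implicit Arguments.
Unset Strict Implicit.
Unset Printing Implicit Defensive.

(** The two Cantor sets are images of a planar Cantor dust under a pair of
    Cauchy transforms.

    Let E be the set of all sums of d_k / 3^k with digits d_k among the four
    numbers (3/8)(1 + i), (3/8)(1 - i), (3/8)(-1 + i), (3/8)(-1 - i), and let mu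
    be its uniform probability measure.  E consists of four disjoint copies of
    itself at scale 1/3, so its dimension log 4 / log 3 exceeds 1.  That makes
    the potential F(z) = int dmu(t) / (z - t) continuous on the whole plane; it
    is holomorphic off E and vanishes at infinity.  Put
    f(z) = (F(z), F(20 - z)), which is continuous on the sphere, holomorphic off
    E and 20 - E, and equal to (0, 0) at infinity.  The sets are X2 = f(E),
    X1 = f(20 - E), which is X2 with the coordinates exchanged, and their union
    X.  The measure is never formed: [potential n] is the mean of 1 / (z - c)
    over the 4^n centres c of generation n, [Phi] and [far_potential] are the
    limits on E and away from E, and [Psi] is F(20 - z) on E.

    Rational hull.  The origin lies in h_r(X), because a polynomial p with
    p(0) not in p(X) would give a function g = p(f) - p(0) that vanishes at
    infinity but not on E or 20 - E.  Small circles around the pieces of these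
    sets are mapped by g into half-planes that avoid 0, so that g would have no
    zero off E and 20 - E, infinity included.  This argument is carried out for
    the rational functions obtained from [potential n].  On each circle Rouche's
    comparison ([rouche_count]) gives at least as many zeros inside as poles,
    while the total number of zeros is smaller than that of poles since the
    function vanishes at infinity ([nonpositive_on_circle]).  A compactness
    argument then produces a zero on X ([zero_in_rational_hull]).  The origin
    is not in X, as F does not vanish on 20 - E.

    Polynomial convexity.  Near E the function F(20 - z) is almost affine, so it
    agrees on E with a bilipschitz bijection [psi] of the plane.  Hence X2 is
    the graph of a continuous function over the planar Cantor set psi(E).  Since
    E is a product of two linear Cantor sets, a point outside E escapes to
    infinity along a horizontal or vertical ray that misses E; pushing a pole
    along the image of the ray shows that 1 / (z - a) is a uniform limit of
    polynomials on psi(E) for each a outside psi(E) ([runge_ray]).  This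
    separates X2 from points that do not lie over psi(E), and, because the holes
    of E at every scale provide poles very close to a given point of psi(E), it
    also separates X2 from points over psi(E) ([polynomially_convex_graph]).

    Cantor sets.  X1 and X2 are injective continuous images of the Cantor space.
    They need not be disjoint; their union is compact, perfect and, by the sum
    theorem for closed zero-dimensional sets, zero-dimensional, hence again a
    Cantor set ([union_cantor_like], [union_embedded]). *)

(** * Modulus of complex numbers *)

Section Modulus.
Variable R : realType.
Local Notation C := R[i].
Local Notation md := (@modulus R).
Implicit Types z w : C.

Lemma modE z : md z = Num.sqrt (complex.Re z ^+ 2 + complex.Im z ^+ 2).
Proof. by rewrite /modulus normc_def. Qed.

Lemma modC z : (md z)%:C%C = `|z|.
Proof. by rewrite modE normc_def. Qed.

Lemma mod_ge0 z : 0 <= md z.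
Proof. by rewrite modE sqrtr_ge0. Qed.

Lemma modM z w : md (z * w) = md z * md w.
Proof. by apply: (@complexI R); rewrite rmorphM /= !modC normrM. Qed.

Lemma modD z w : md (z + w) <= md z + md w.
Proof. by rewrite -lecR rmorphD /= !modC ler_normD. Qed.

Lemma modN z : md (- z) = md z.
Proof. by rewrite /modulus normrN. Qed.

Lemma modBC z w : md (z - w) = md (w - z).
Proof. by rewrite -modN opprB. Qed.

Lemma modB z w : md (z - w) <= md z + md w.
Proof. by rewrite (le_trans (modD _ _)) ?modN. Qed.

Lemma modBge z w : md z - md w <= md (z - w).
Proof. by have := modD (z - w) w; rewrite subrK; lra. Qed.

Lemma modDge z w : md z - md w <= md (z + w).
Proof. by have := modBge z (- w); rewrite opprK modN. Qed.

Lemma modDist (a b c : C) : md (a - c) <= md (a - b) + md (b - c).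
Proof. by have := modD (a - b) (b - c); rewrite addrA subrK. Qed.

Lemma modV z : md z^-1 = (md z)^-1.
Proof.
by apply: (@complexI R); rewrite fmorphV /= !modC normfV.
Qed.

Lemma modX z n : md (z ^+ n) = md z ^+ n.
Proof. by apply: (@complexI R); rewrite rmorphXn /= !modC normrX. Qed.

Lemma mod0 : md 0 = 0.
Proof. by rewrite /modulus normr0. Qed.

Lemma mod1 : md 1 = 1.
Proof. by rewrite /modulus normr1. Qed.

Lemma mod_eq0 z : (md z == 0) = (z == 0).
Proof.
by rewrite -(inj_eq (@complexI R)) modC normr_eq0.
Qed.

Lemma mod_gt0 z : (0 < md z) = (z != 0).
Proof. by rewrite lt0r mod_eq0 mod_ge0 andbT. Qed.

Lemma mod_real (x : R) : md x%:C%C = `|x|.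
Proof. by rewrite modE /= expr0n /= addr0 sqrtr_sqr. Qed.

Lemma mod_nat n : md n%:R = n%:R.
Proof. by rewrite -(rmorph_nat (real_complex R)) /= mod_real normr_nat. Qed.

Lemma mod_conj z : md (z^*)%C = md z.
Proof. by case: z => a b; rewrite !modE /= sqrrN. Qed.

Lemma mod_sqr z : md z ^+ 2 = complex.Re z ^+ 2 + complex.Im z ^+ 2.
Proof. by rewrite modE sqr_sqrtr // addr_ge0 // sqr_ge0. Qed.

Lemma Re_le_mod z : `|complex.Re z| <= md z.
Proof. by rewrite modE -sqrtr_sqr ler_wsqrtr // lerDl sqr_ge0. Qed.

Lemma Im_le_mod z : `|complex.Im z| <= md z.
Proof. by rewrite modE -sqrtr_sqr ler_wsqrtr // lerDr sqr_ge0. Qed.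

Lemma mod_le_ReIm z : md z <= `|complex.Re z| + `|complex.Im z|.
Proof.
rewrite -(@ler_pXn2r _ 2) ?nnegrE ?mod_ge0 ?addr_ge0 // mod_sqr.
rewrite sqrrD !real_normK ?num_real //.
have : 0 <= `|complex.Re z| * `|complex.Im z| by rewrite mulr_ge0.
by lra.
Qed.

Lemma ReD z w : complex.Re (z + w) = complex.Re z + complex.Re w.
Proof. by rewrite raddfD. Qed.

Lemma ReB z w : complex.Re (z - w) = complex.Re z - complex.Re w.
Proof. by rewrite raddfB. Qed.

Lemma ImD z w : complex.Im (z + w) = complex.Im z + complex.Im w.
Proof. by rewrite raddfD. Qed.

Lemma ImB z w : complex.Im (z - w) = complex.Im z - complex.Im w.
Proof. by rewrite raddfB. Qed.

Lemma mulJ z : z * (z^*)%C = (md z ^+ 2)%:C%C.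
Proof.
by case: z => a b; rewrite mod_sqr /=; simpc; rewrite -!expr2 [b * a]mulrC addNr.
Qed.

Lemma mod_sum (I : Type) (r : seq I) (P : pred I) (f : I -> C) :
  md (\sum_(i <- r | P i) f i) <= \sum_(i <- r | P i) md (f i).
Proof.
elim/big_rec2: _ => [|i x y _ le]; first by rewrite mod0.
by rewrite (le_trans (modD _ _)) // lerD2l.
Qed.

Lemma mkReIm (z : C) : (complex.Re z +i* complex.Im z)%C = z.
Proof. by case: z. Qed.

Lemma Re_scale (u : R) (v : C) : complex.Re (u%:C%C * v) = u * complex.Re v.
Proof. by case: v => v1 v2 /=; ring. Qed.

Lemma Im_scale (u : R) (v : C) : complex.Im (u%:C%C * v) = u * complex.Im v.
Proof. by case: v => v1 v2 /=; ring. Qed.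

Lemma Re_conj (v : C) : complex.Re (v^*)%C = complex.Re v.
Proof. by case: v. Qed.

Lemma conjcB (z w : C) : ((z - w)^*)%C = (z^*)%C - (w^*)%C.
Proof. exact: rmorphB. Qed.

Lemma conjcM (z w : C) : ((z * w)^*)%C = (z^*)%C * (w^*)%C.
Proof. exact: rmorphM. Qed.

Lemma conjcX (z : C) n : ((z ^+ n)^*)%C = (z^*)%C ^+ n.
Proof. exact: rmorphXn. Qed.

Lemma conjcV (z : C) : ((z^-1)^*)%C = (z^*)%C^-1.
Proof. exact: fmorphV. Qed.

End Modulus.

(** * Continuity and compactness in the complex plane *)

Section PlaneTopology.
Variable R : realType.
Local Notation C := R[i].
Local Notation md := (@modulus R).

Lemma poly_cont (p : {poly C}) : continuous (fun z : C => p.[z]).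
Proof.
elim/poly_ind: p => [|p c IH] z.
  have -> : (fun z : C => (0 : {poly C}).[z]) = cst 0 by apply/funext => x;
    rewrite horner0.
  apply: cst_continuous.
have -> : (fun z : C => (p * 'X + c%:P).[z]) = (fun z => p.[z] * z + c).
  by apply/funext => x; rewrite hornerMXaddC.
exact: (cvgD (cvgM (IH z) cvg_id) (cvg_cst c)).
Qed.

Lemma Re_cont : continuous (@complex.Re R).
Proof.
move=> z; apply: (iffRL (@cvgrPdist_lt _ _ _ _ (nbhs_filter z) _ _)) => e e0.
have e0' : 0 < e%:C%C :> C by rewrite ltcR.
near=> w.
rewrite -ReB; apply: (le_lt_trans (Re_le_mod _)).
rewrite -ltcR modC.
near: w.
exact: (@cvgr_dist_lt C C C (nbhs z) _ id z cvg_id _ e0').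
Unshelve. all: by end_near. Qed.

Lemma Im_cont : continuous (@complex.Im R).
Proof.
move=> z; apply: (iffRL (@cvgrPdist_lt _ _ _ _ (nbhs_filter z) _ _)) => e e0.
have e0' : 0 < e%:C%C :> C by rewrite ltcR.
near=> w.
rewrite -ImB; apply: (le_lt_trans (Im_le_mod _)).
rewrite -ltcR modC.
near: w.
exact: (@cvgr_dist_lt C C C (nbhs z) _ id z cvg_id _ e0').
Unshelve. all: by end_near. Qed.

Lemma complex_pair_cont : continuous (fun x : R * R => x.1 +i* x.2)%C.
Proof.
move=> x; apply: (iffRL (@cvgrPdist_lt _ _ _ _ (nbhs_filter x) _ _)) => e e0.
have [d d0 ed] : exists2 d : R, 0 < d & e = d%:C%C.
  case: e e0 => a b; rewrite ltcE /= => /andP[/eqP -> a0].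
  by exists a.
have d2 : 0 < d / 2 by rewrite divr_gt0.
rewrite ed; near=> y.
rewrite -modC ltcR.
apply: (le_lt_trans (mod_le_ReIm _)); rewrite ReB ImB /=.
suff [h1 h2] : `|x.1 - y.1| < d / 2 /\ `|x.2 - y.2| < d / 2 by lra.
split; near: y.
  exact: (@cvgr_dist_lt R R _ (nbhs x) _ fst x.1 cvg_fst _ d2).
exact: (@cvgr_dist_lt R R _ (nbhs x) _ snd x.2 cvg_snd _ d2).
Unshelve. all: by end_near. Qed.

Lemma mod_cont : continuous (@modulus R : C -> R).
Proof.
move=> z.
have H : (`|w| : C) @[w --> z] --> `|z|.
  exact: (@cvg_norm _ _ _ _ (nbhs_filter z) id z cvg_id).
exact: (cvg_comp _ _ H (@Re_cont _)).
Qed.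

(** Translates a neighbourhood in the plane, whose radii are complex numbers,
    to a disc with a radius in [R]. *)
Lemma near_disc (P : C -> Prop) (a : C) : (\forall z \near a, P z) ->
  exists2 d : R, 0 < d & forall z, md (z - a) < d -> P z.
Proof.
move=> /(@nbhs_ballP C) [e /= e0 H].
have [d d0 ed] : exists2 d : R, 0 < d & e = d%:C%C.
  case: e e0 {H} => a1 b; rewrite ltcE /= => /andP[/eqP -> a0].
  by exists a1.
exists d => // z zd; apply: H.
by rewrite -ball_normE /= ed -modC ltcR modBC.
Qed.

Lemma Re_quotient_cont (T U : {poly C}) (a : C) : U.[a] != 0 ->
  {for a, continuous (fun z : C => complex.Re (T.[z] / U.[z]))}.
Proof.
move=> Ua.
have H : (T.[z] / U.[z]) @[z --> a] --> T.[a] / U.[a].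
  exact: (cvgM (@poly_cont T a) (cvgV Ua (@poly_cont U a))).
exact: (@cvg_comp _ _ _ _ (@complex.Re R) _ _ _ H (@Re_cont _)).
Qed.

Lemma compact_disc (c : C) (r : R) :
  compact [set x : R * R | md ((x.1 +i* x.2)%C - c) <= r].
Proof.
pose B := `[complex.Re c - r, complex.Re c + r]%classic `*`
          `[complex.Im c - r, complex.Im c + r]%classic.
apply: (@subclosed_compact _ _ B).
- pose f := fun x : R * R => md ((x.1 +i* x.2)%C - c).
  have fc : continuous f.
    move=> x; rewrite /f.
    have H1 := cvgB (@complex_pair_cont x) (@cvg_cst _ c _ (nbhs x) _).
    have H2 : (`|(y.1 +i* y.2)%C - c| : C) @[y --> x] --> `|(x.1 +i* x.2)%C - c|.
      exact: (@cvg_norm _ _ _ _ (nbhs_filter x) _ _ (H1 (nbhs_filter x) (nbhs_filter x))).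
    exact: (cvg_comp _ _ H2 (@Re_cont _)).
  exact: (closed_comp (fun x _ => fc x) (@closed_le R r)).
- by apply: compact_setX; exact: segment_compact.
- move=> x /= h.
  have h1 := le_trans (Re_le_mod _) h; have h2 := le_trans (Im_le_mod _) h.
  move: h1 h2; rewrite ReB ImB /= !ler_norml => /andP[? ?] /andP[? ?].
  by split; rewrite /= in_itv /=; apply/andP; split; lra.
Qed.
End PlaneTopology.

(** * Zeros and poles of rational functions in a disc *)

Section MinimumPrinciple.
Variable R : realType.
Local Notation C := R[i].
Local Notation md := (@modulus R).

(** The minimum principle for the harmonic function Re (T / U), which is 0 at
    the centre: if it were positive on the circle, its minimum over the disc
    would be attained inside, and T / U, being open there, takes nearby values
    of smaller real part. *)
Lemma min_principle (T U : {poly C}) (c : C) (r : R) : 0 < r ->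
  T.[c] = 0 -> (forall z, md (z - c) <= r -> U.[z] != 0) ->
  exists2 y, md (y - c) = r & complex.Re (T.[y] / U.[y]) <= 0.
Proof.
move=> r0 Tc Un; apply: contrapT => /forall2NP Hpos.
have pos y : md (y - c) = r -> 0 < complex.Re (T.[y] / U.[y]).
  by move=> yr; case: (Hpos y) => // /negP; rewrite -ltNge.
pose f x := complex.Re (T.[x] / U.[x]).
pose A := [set x : R * R | md ((x.1 +i* x.2)%C - c) <= r].
have mkc : ((complex.Re c, complex.Im c).1 +i* (complex.Re c, complex.Im c).2)%C = c.
  exact: mkReIm.
have A0 : A !=set0.
  exists (complex.Re c, complex.Im c).
  by rewrite /A /= mkReIm subrr mod0 ltW.
have fA : {within A, continuous (fun x : R * R => f (x.1 +i* x.2)%C)}.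
  apply: continuous_in_subspaceT => x /set_mem /= Ax.
  exact: (cvg_comp _ f (@complex_pair_cont R x) (@Re_quotient_cont _ T U _ (Un _ Ax))).
have [x0 /set_mem Ax0 minx0] := compact_EVT_min A0 (@compact_disc _ c r) fA.
set a := (x0.1 +i* x0.2)%C in minx0.
have mina y : md (y - c) <= r -> f a <= f y.
  move=> yr; have := minx0 (complex.Re y, complex.Im y).
  by rewrite /= mkReIm; apply; apply/mem_set; rewrite /A /= mkReIm.
have fc : f c = 0 by rewrite /f Tc mul0r.
have fa0 : f a <= 0 by rewrite -fc; apply: mina; rewrite subrr mod0 ltW.
have ar : md (a - c) < r.
  rewrite lt_neqAle Ax0 andbT; apply/negP => /eqP /pos.
  by rewrite -/(f a) ltNge fa0.
have Ua : U.[a] != 0 by apply: Un; apply: ltW.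
have Uc : U.[c] != 0 by apply: Un; rewrite subrr mod0 ltW.
pose h := T.[a] / U.[a].
pose W := T - h *: U.
have Wn0 : W != 0.
  apply/negP => /eqP W0.
  have TE : T = h *: U by apply/eqP; rewrite -subr_eq0 -/W W0.
  have h0 : h = 0.
    move: Tc; rewrite TE hornerZ => /eqP; rewrite mulf_eq0 (negbTE Uc) orbF.
    by move/eqP.
  have := pos (c + r%:C%C).
  rewrite addrAC subrr add0r mod_real ger0_norm ?(ltW r0) // => /(_ erefl).
  by rewrite TE h0 scale0r horner0 mul0r ltxx.
have [m [q qa Wq]] := multiplicity_XsubC W a.
have {}qa : q.[a] != 0 by move: qa; rewrite Wn0 => /implyP; exact.
have m0 : (0 < m)%N.
  case: m Wq => // Wq; exfalso; move: qa; rewrite -[q]mulr1 -Wq.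
  by rewrite /W !hornerE /h divfK // subrr eqxx.
pose s := q.[a] / U.[a].
have s0 : s != 0 by rewrite mulf_neq0 ?invr_eq0.
(* The direction in which the leading term of T / U - h becomes negative. *)
pose th : C := m.-root (- s^-1).
have thm : th ^+ m = - s^-1 by rewrite rootCK.
pose q2 := th ^+ m *: q.
have q2a : complex.Re (q2.[a] / U.[a]) = -1.
  by rewrite /q2 hornerZ -mulrA -/s thm mulNr mulVf.
have [d d0 Hd] : exists2 d : R, 0 < d &
    forall z, md (z - a) < d -> complex.Re (q2.[z] / U.[z]) < 0.
  apply: near_disc.
  apply: (@cvgr_lt R C (nbhs a) (nbhs_filter a) _ _ (@Re_quotient_cont _ q2 U a Ua)).
  by rewrite q2a ltrN10.
pose t := Num.min d (r - md (a - c)) / (2 * (md th + 1)).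
have th1 : 0 < md th + 1 by rewrite ltr_wpDl ?mod_ge0.
have min0 : 0 < Num.min d (r - md (a - c)) by rewrite lt_min d0 subr_gt0.
have t0 : 0 < t by rewrite divr_gt0 // mulr_gt0.
pose y := a + t%:C%C * th.
have ya : md (y - a) < Num.min d (r - md (a - c)).
  rewrite /y addrAC subrr add0r modM mod_real gtr0_norm //.
  have -> : Num.min d (r - md (a - c)) = t * (2 * (md th + 1)).
    by rewrite /t divfK // gt_eqF // mulr_gt0.
  by rewrite ltr_pM2l //; have := mod_ge0 th; lra.
have yr : md (y - c) <= r.
  have := modDist y a c; move: ya; rewrite lt_min => /andP[_]; lra.
have Uy := Un _ yr.
have : f y < f a.
  rewrite -subr_lt0 /f -ReB.
  have -> : T.[y] / U.[y] - T.[a] / U.[a] = (t ^+ m)%:C%C * (q2.[y] / U.[y]).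
    rewrite -/h; have -> : T.[y] / U.[y] - h = W.[y] / U.[y].
      by rewrite /W !hornerE mulrBl mulfK.
    rewrite Wq hornerM horner_exp hornerXsubC /q2 hornerZ.
    have -> : y - a = t%:C%C * th by rewrite /y [a + _]addrC addrK.
    by rewrite exprMn rmorphXn; ring.
  have -> : forall (u : R) (v : C), complex.Re (u%:C%C * v) = u * complex.Re v.
    by move=> u [v1 v2] /=; ring.
  rewrite pmulr_rlt0 ?exprn_gt0 //; apply: Hd.
  by move: ya; rewrite lt_min => /andP[].
by rewrite ltNge mina.
Qed.
End MinimumPrinciple.

Section ArgumentPrinciple.
Variable R : realType.
Local Notation C := R[i].
Local Notation md := (@modulus R).

Lemma invC_conj (z : C) : z^-1 = ((md z ^+ 2)^-1)%:C%C * (z^*)%C.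
Proof.
have [->|z0] := eqVneq z 0; first by rewrite invr0 conjc0 mulr0.
have zc0 : (z^*)%C != 0 by rewrite conjc_eq0.
by rewrite fmorphV /= -mulJ invfM -mulrA mulVf ?mulr1.
Qed.

Lemma Re_mulJ_gt0 (z w : C) : 0 < complex.Re (z * (w^*)%C) ->
  0 < complex.Re (w / z).
Proof.
move=> h; have z0 : z != 0.
  by apply: contraTN h => /eqP ->; rewrite mul0r ltxx.
rewrite invC_conj mulrCA Re_scale mulr_gt0 ?invr_gt0 ?exprn_gt0 ?mod_gt0 //.
by rewrite -Re_conj conjcM conjcK mulrC.
Qed.

Section Disc.
Variables (c : C) (r : R).
Hypothesis r0 : 0 < r.
Let inD (a : C) := md (a - c) < r.
Let star (a : C) : {poly C} := (r ^+ 2)%:C%C%:P - ((a - c)^*)%C *: ('X - c%:P).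

Let starE a y : (star a).[y] = (r ^+ 2)%:C%C - ((a - c)^*)%C * (y - c).
Proof. by rewrite /star !hornerE. Qed.

Let star_neq0 a y : inD a -> md (y - c) <= r -> (star a).[y] != 0.
Proof.
rewrite starE subr_eq0 => ia yr; apply/negP => /eqP /(congr1 md).
rewrite mod_real modM mod_conj ger0_norm ?sqr_ge0 // expr2 => e.
have : md (a - c) * md (y - c) < r * r.
  apply: (@le_lt_trans _ _ (md (a - c) * r)); first by rewrite ler_wpM2l ?mod_ge0.
  by rewrite ltr_pM2r.
by rewrite -e ltxx.
Qed.

Let r2C : (r ^+ 2)%:C%C != 0 :> C.
Proof. by rewrite -mod_gt0 mod_real normr_gt0 expf_neq0 ?gt_eqF. Qed.

Let circ y : md (y - c) = r -> (y - c) * ((y - c)^*)%C = (r ^+ 2)%:C%C.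
Proof. by move=> yr; rewrite mulJ yr. Qed.

Let factor a y : md (y - c) = r ->
  y - a = (y - c) / (r ^+ 2)%:C%C * (((star a).[y])^*)%C.
Proof.
move=> yr; rewrite starE (conjcB (r ^+ 2)%:C%C) conjcM conjc_real conjcK mulrBr divfK
  ?r2C //.
rewrite mulrC -mulrA -(circ yr).
have y0 : y - c != 0 by rewrite -mod_gt0 yr.
have yc0 : ((y - c)^*)%C != 0 by rewrite conjc_eq0.
have -> : ((y - c)^*)%C * ((y - c) / ((y - c) * ((y - c)^*)%C)) = 1.
  by rewrite mulrA [X in X / _]mulrC divff // mulf_neq0.
by rewrite mulr1; ring.
Qed.

Let factors (s : seq C) y : md (y - c) = r ->
  \prod_(a <- s | inD a) (y - a) =
  ((y - c) / (r ^+ 2)%:C%C) ^+ count inD s *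
  ((\prod_(a <- s | inD a) (star a).[y])^*)%C.
Proof.
move=> yr; elim: s => [|a s IH]; first by rewrite !big_nil conjc1 mulr1.
rewrite !big_cons [count _ _]/=; case: (inD a) => //.
rewrite IH conjcM [in LHS](factor a yr) add1n [in RHS](exprS ((y - c) / _)); ring.
Qed.

(** Let P / Q be the quotient.  On the circle a factor y - a with a inside equals
    (y - c) / r^2 times the conjugate of a polynomial [star a] without zeros in
    the disc.  If P had fewer zeros, collecting these factors would show P / Q to
    be a positive multiple of Z times the conjugate of W, where W has the factor
    y - c and W / Z is holomorphic in the disc.  Then Re (W / Z) is positive on the
    circle as well but vanishes at c, against [min_principle]. *)
Lemma rouche_count (lp : C) (s t : seq C) :
  (forall y, md (y - c) = r ->
    0 < complex.Re ((lp * \prod_(a <- s) (y - a)) / \prod_(b <- t) (y - b))) ->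
  (count inD t <= count inD s)%N.
Proof.
move=> pos; rewrite leqNgt; apply/negP => ltst.
pose m := (count inD t - count inD s)%N.
have m0 : (0 < m)%N by rewrite subn_gt0.
pose V := \prod_(a <- s | inD a) star a * \prod_(b <- t | ~~ inD b) ('X - b%:P).
pose U := lp *: (\prod_(a <- s | ~~ inD a) ('X - a%:P) * \prod_(b <- t | inD b) star b).
pose T := ((r ^+ 2)%:C%C^-1 *: ('X - c%:P)) ^+ m * V.
have Tc : T.[c] = 0.
  by rewrite /T hornerM horner_exp hornerZ hornerXsubC subrr mulr0 expr0n eqn0Ngt m0
    mul0r.
have cr : md (c + r%:C%C - c) = r by rewrite addrAC subrr add0r mod_real gtr0_norm.
have lp0 : lp != 0.
  by apply: contraTN (pos _ cr) => /eqP ->; rewrite !mul0r ltxx.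
have UE y : U.[y] = lp * (\prod_(a <- s | ~~ inD a) (y - a) * \prod_(b <- t | inD b)
  (star b).[y]).
  rewrite /U hornerZ hornerM !horner_prod.
  by under eq_bigr do rewrite hornerXsubC.
have sy y a : md (y - c) = r -> a \in s -> y != a.
  move=> yr ain; apply: contraTN (pos _ yr) => /eqP ya.
  by rewrite (big_rem a ain) /= ya subrr mul0r mulr0 mul0r ltxx.
have Un y : md (y - c) <= r -> U.[y] != 0.
  move=> yr; rewrite UE mulf_neq0 // mulf_neq0 // prodf_seq_neq0; apply/allP => a ain.
    apply/implyP => nia; rewrite subr_eq0.
    move: yr; rewrite le_eqVlt => /orP[/eqP yr|yr]; first exact: sy.
    by apply: contraNneq nia => <-.
  by apply/implyP => ia; apply: star_neq0.
have [y yr] := min_principle r0 Tc Un.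
apply/negP; rewrite -ltNge.
have := pos _ yr; rewrite (bigID inD) /= [X in _ / X](bigID inD) /= !factors //.
set v := (y - c) / _.
set A1 := \prod_(a <- s | inD a) _; set A2 := \prod_(a <- s | ~~ inD a) _.
set B1 := \prod_(a <- t | inD a) _; set B2 := \prod_(a <- t | ~~ inD a) _.
move=> h.
have -> : T.[y] = v ^+ m * (A1 * B2).
  rewrite /T /V hornerM horner_exp hornerZ hornerXsubC hornerM !horner_prod.
  by congr (_ ^+ _ * (_ * _)); [rewrite mulrC | apply: eq_bigr => i _;
    rewrite hornerXsubC].
rewrite UE -/A2 -/B1.
have nz (x : C) : x * 0^-1 = 0 by rewrite invr0 mulr0.
have den0 : v ^+ count inD t * (B1^*)%C * B2 != 0.
  by apply: contraTN h => /eqP ->; rewrite invr0 mulr0 ltxx.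
have num0 : lp * (v ^+ count inD s * (A1^*)%C * A2) != 0.
  by apply: contraTN h => /eqP ->; rewrite mul0r ltxx.
move: den0 num0; rewrite !mulf_eq0 !negb_or !conjc_eq0.
move=> /andP[/andP[vt0 B10] B20] /andP[_ /andP[/andP[vs0 A10] A20]].
have y0 : y - c != 0 by rewrite -mod_gt0 yr.
have v0 : v != 0 by rewrite mulf_neq0 // invr_eq0.
have vc0 : (v^*)%C != 0 by rewrite conjc_eq0.
have B1c : (B1^*)%C != 0 by rewrite conjc_eq0.
have vv : v * (v^*)%C = ((r ^+ 2)^-1)%:C%C.
  rewrite mulJ /v modM modV mod_real ger0_norm ?sqr_ge0 // yr.
  by congr (_ %:C%C); field; rewrite gt_eqF.
have -> : v ^+ m * (A1 * B2) / (lp * (A2 * B1)) = (v ^+ m * A1 / B1) / (lp * A2 / B2).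
  by field; rewrite lp0 A20 B10 B20.
apply: Re_mulJ_gt0.
rewrite !conjcM conjcX conjcV.
move: h.
have -> : lp * (v ^+ count inD s * (A1^*)%C * A2) / (v ^+ count inD t * (B1^*)%C * B2) =
  ((r ^+ 2) ^+ m)%:C%C * (lp * A2 / B2 * ((v^*)%C ^+ m * (A1^*)%C / (B1^*)%C)).
  have -> : ((r ^+ 2) ^+ m)%:C%C = (v ^+ m * (v^*)%C ^+ m)^-1.
    by rewrite -exprMn vv rmorphXn /= fmorphV /= exprVn invrK.
  have -> : v ^+ count inD t = v ^+ m * v ^+ count inD s by rewrite -exprD subnK // ltnW.
  have vm0 : v ^+ m != 0 by rewrite expf_neq0.
  have vcm0 : (v^*)%C ^+ m != 0 by rewrite expf_neq0.
  by field; rewrite vs0 B1c B20 vm0 vcm0.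
by rewrite Re_scale pmulr_rgt0 // exprn_gt0 // exprn_gt0.
Qed.
End Disc.
End ArgumentPrinciple.

Section CountingZeros.
Variable R : realType.
Local Notation C := R[i].
Local Notation md := (@modulus R).

(** If all the quotients had positive real part, each disc would contain at least
    m zeros of P; as the discs are disjoint, P would have at least m * size L
    zeros, more than its degree allows. *)
Lemma nonpositive_on_circle (L : seq C) (m : nat) (r : R) (P : {poly C}) (g : C -> C) :
  0 < r -> uniq L -> (0 < size L)%N ->
  (forall c c', c \in L -> c' \in L -> c != c' -> 2 * r <= md (c - c')) ->
  (size P <= m * size L)%N ->
  exists2 c, c \in L & exists2 y, md (y - c) = r &
    complex.Re (P.[y] / (\prod_(b <- L) (y - b)) ^+ m * g c) <= 0.
Proof.
move=> r0 uL L0 sepL szP; apply: contrapT => /forall2NP Hneg.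
have pos c y : c \in L -> md (y - c) = r ->
    0 < complex.Re (P.[y] / (\prod_(b <- L) (y - b)) ^+ m * g c).
  move=> cL yr; rewrite ltNge; apply/negP => le0.
  by case: (Hneg c) => // H; apply: H; exists y.
have [s Ps] := closed_field_poly_normal P.
have Pn0 : P != 0.
  apply/eqP => P0; case: L L0 pos {uL sepL szP Hneg} => // c L _ pos.
  have := pos c (c + r%:C%C) (mem_head _ _).
  rewrite addrAC subrr add0r mod_real gtr0_norm // => /(_ erefl).
  by rewrite P0 horner0 !mul0r ltxx.
have szs : size P = (size s).+1.
  by rewrite Ps size_scale ?lead_coef_eq0 // size_prod_XsubC.
pose t := flatten (nseq m L).
have tE y : \prod_(b <- t) (y - b) = (\prod_(b <- L) (y - b)) ^+ m.
  rewrite /t; elim: m {szP Hneg pos t} => [|m IH]; first by rewrite big_nil.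
  by rewrite /= big_cat /= IH exprS.
have ctE (a : pred C) : count a t = (m * count a L)%N.
  rewrite /t; elim: m {szP Hneg pos t tE} => [|m IH] //=.
  by rewrite count_cat IH mulSn.
have main c : c \in L -> (m <= count (fun a => (md (a - c) < r)%R) s)%N.
  move=> cL; apply: leq_trans (@rouche_count R c r r0 (lead_coef P * g c) s t _).
    rewrite ctE leq_pmulr // -has_count; apply/hasP; exists c => //.
    by rewrite subrr mod0.
  move=> y yr; have := pos _ _ cL yr; rewrite tE {1}Ps hornerZ horner_prod.
  have -> : \prod_(a <- s) ('X - a%:P).[y] = \prod_(a <- s) (y - a).
    by apply: eq_bigr => i _; rewrite hornerXsubC.
  by rewrite mulrAC [lead_coef P * _ * g c]mulrAC.
have : (m * size L <= size s)%N.
  have -> : (m * size L = \sum_(c <- L) m)%N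
    by rewrite big_const_seq count_predT iter_addn_0.
  apply: (@leq_trans (\sum_(c <- L) count (fun a => (md (a - c) < r)%R) s)).
    by rewrite big_seq [leqRHS]big_seq; apply: leq_sum.
  have -> : (\sum_(c <- L) count (fun a => (md (a - c) < r)%R) s =
     \sum_(a <- s) count (fun c => (md (a - c) < r)%R) L)%N.
    under eq_bigr do rewrite -sum1_count big_mkcond.
    rewrite exchange_big /=; apply: eq_bigr => a _.
    by rewrite -sum1_count [RHS]big_mkcond.
  rewrite -sum1_size; apply: leq_sum => a _.
  rewrite leqNgt; apply/negP => c2.
  have : (1 < size (seq.filter (fun c => (md (a - c) < r)%R) L))%N by rewrite size_filter.
  have := filter_uniq (fun c => (md (a - c) < r)%R) uL.
  have : all (fun c => (md (a - c) < r)%R && (c \in L)) (seq.filter (fun c => (md (a -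
    c) < r)%R) L).
    by apply/allP => c; rewrite mem_filter.
  case: (seq.filter _ L) => [|c [|c' l]] //= /andP[/andP[h1 cL] /andP[/andP[h2 c'L] _]].
  rewrite inE negb_or => /andP[/andP[cc' _] _] _.
  have := sepL _ _ cL c'L cc'; have := modDist c a c'; rewrite (modBC c a); lra.
by move: szP; rewrite szs => h1 h2; have := leq_trans h1 h2; rewrite ltnn.
Qed.
End CountingZeros.

(** * A planar Cantor dust and its potentials *)

Section Dust.
Variable R : realType.
Local Notation C := R[i].
Local Notation md := (@modulus R).
Notation D := (bool * bool)%type.

Definition bsign (b : bool) : R := if b then 1 else -1.
(** The factor 3/8 makes the four discs of radius 1/3 around the digits disjoint
    and keeps them inside the unit disc. *)
Definition digit (d : D) : C := (3 / 8 * bsign d.1 +i* (3 / 8 * bsign d.2))%C.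
Definition centre (w : seq D) : C := foldr (fun d c => digit d + 3^-1 * c) 0 w.

Lemma digit_sqr d : md (digit d) ^+ 2 = 9 / 32.
Proof. by rewrite mod_sqr /= /bsign; case: d => [[] []] /=; lra. Qed.

Lemma digit_le d : md (digit d) <= 8 / 15.
Proof.
rewrite -(@ler_pXn2r _ 2) ?nnegrE ?mod_ge0 ?digit_sqr //; rewrite ?expr2; lra.
Qed.

Lemma digit_ge d : 1 / 2 <= md (digit d).
Proof.
rewrite -(@ler_pXn2r _ 2) ?nnegrE ?mod_ge0 ?digit_sqr //; rewrite ?expr2; lra.
Qed.

Lemma digit_sep d d' : d != d' -> 3 / 4 <= md (digit d - digit d').
Proof.
case: d d' => [a b] [a' b'] neq.
have [aa|aa] := eqVneq a a'.
  have bb : b != b' by apply: contraNneq neq => ->; rewrite aa.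
  apply: le_trans (Im_le_mod _); rewrite ImB /= /bsign.
  by case: b b' bb {neq} => [] [] //= _; rewrite ler_normr; apply/orP; [left|right]; lra.
apply: le_trans (Re_le_mod _); rewrite ReB /= /bsign.
by case: a a' aa {neq} => [] [] //= _; rewrite ler_normr; apply/orP; [left|right]; lra.
Qed.

Lemma mod3V : md 3^-1 = 3^-1.
Proof. by rewrite modV mod_nat. Qed.

Lemma mod3VX n : md (3^-1 ^+ n) = 3^-1 ^+ n.
Proof. by rewrite modX mod3V. Qed.

Lemma pow3_gt0 n : 0 < 3^-1 ^+ n :> R.
Proof. by rewrite exprn_gt0 // invr_gt0. Qed.

Lemma pow3_le1 n : 3^-1 ^+ n <= 1 :> R.
Proof. by rewrite exprn_ile1 ?invr_ge0 // invf_le1 // ler1n. Qed.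

Lemma centre_le w : md (centre w) <= 4 / 5.
Proof.
elim: w => [|d w IH] /=; first by rewrite mod0; lra.
have := modD (digit d) (3^-1 * centre w); rewrite modM mod3V.
by have := digit_le d; lra.
Qed.

(** Keeps the circles around the pieces inside one quarter of the dust away from
    the other quarters, in [centre_sep] and [potential_circle]. *)
Lemma centre_nested w : md (centre w) + 3^-1 ^+ size w <= 1.
Proof.
elim: w => [|d w IH] /=; first by rewrite mod0 expr0; lra.
have := modD (digit d) (3^-1 * centre w); rewrite modM mod3V exprS.
by have := digit_le d; lra.
Qed.

Lemma centre_rcons w d : centre (rcons w d) = centre w + 3^-1 ^+ size w * digit d.
Proof.
elim: w => [|e w IH] /=; first by rewrite expr0 mul1r mulr0 addr0 add0r.
by rewrite IH exprS; ring.
Qed.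

Lemma centre_sep w w' : size w = size w' -> w != w' ->
  2 * 3^-1 ^+ size w <= md (centre w - centre w').
Proof.
elim: w w' => [|d w IH] [|d' w'] //= [sw] neq.
have [dd|dd] := eqVneq d d'.
  have ww : w != w' by apply: contraNneq neq => ->; rewrite dd.
  have := IH _ sw ww.
  have -> : digit d + 3^-1 * centre w - (digit d' + 3^-1 * centre w') =
    3^-1 * (centre w - centre w').
    by rewrite dd; ring.
  by rewrite modM mod3V exprS; lra.
have h := digit_sep dd; have h1 := centre_nested w; have h2 := centre_nested w'.
have := modBge (digit d - digit d') (3^-1 * (centre w' - centre w)).
have -> : digit d - digit d' - 3^-1 * (centre w' - centre w) =
  digit d + 3^-1 * centre w - (digit d' + 3^-1 * centre w') by ring.
rewrite modM mod3V; have := modB (centre w') (centre w); rewrite exprS sw in h1 *.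
by lra.
Qed.

(** Recursion on the first letter; [mean_rcons] splits off the last one instead. *)
Fixpoint mean (n : nat) (f : seq D -> C) : C :=
  if n is n'.+1 then 4^-1 * \sum_(d : D) mean n' (fun w => f (d :: w)) else f [::].

Lemma eq_mean n f g : (forall w, size w = n -> f w = g w) -> mean n f = mean n g.
Proof.
elim: n f g => [|n IH] f g fg /=; first exact: fg.
by congr (_ * _); apply: eq_bigr => d _; apply: IH => w sw; apply: fg; rewrite /= sw.
Qed.

Lemma meanB n f g : mean n (fun w => f w - g w) = mean n f - mean n g.
Proof.
elim: n f g => [|n IH] f g //=.
by rewrite -mulrBr -sumrB; congr (_ * _); apply: eq_bigr => d _; rewrite IH.
Qed.

Lemma meanZ n a f : mean n (fun w => a * f w) = a * mean n f.
Proof.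
elim: n f => [|n IH] f //=.
rewrite mulrCA; congr (_ * _); rewrite mulr_sumr.
by apply: eq_bigr => d _; rewrite IH.
Qed.

Lemma card_D : #|{: D}| = 4%N.
Proof. by rewrite card_prod card_bool. Qed.

Lemma mod4V : md 4^-1 = 4^-1.
Proof. by rewrite modV mod_nat. Qed.

Lemma mod_mean4 (f : D -> C) (M : R) : (forall d, md (f d) <= M) ->
  md (4^-1 * \sum_(d : D) f d) <= M.
Proof.
move=> fM; rewrite modM mod4V.
have h : md (\sum_(d : D) f d) <= \sum_(d : D) M.
  by apply: (le_trans (mod_sum _ _ _)); apply: ler_sum.
move: h; rewrite sumr_const card_D -mulr_natl; lra.
Qed.

Lemma mean_le n f (M : R) : (forall w, size w = n -> md (f w) <= M) -> md (mean n f) <= M.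
Proof.
elim: n f => [|n IH] f fM /=; first exact: fM.
by apply: mod_mean4 => d; apply: IH => w sw; apply: fM; rewrite /= sw.
Qed.

Lemma mean_rcons n f :
  mean n.+1 f = mean n (fun w => 4^-1 * \sum_(d : D) f (rcons w d)).
Proof.
elim: n f => [|n IH] f //.
rewrite [LHS]/= [RHS]/=; congr (_ * _); apply: eq_bigr => d _.
exact: (IH (fun w => f (d :: w))).
Qed.

Definition potential n z := mean n (fun w => (z - centre w)^-1).

(** Self-similarity; the factor 3/4 < 1 is what makes the potentials converge on
    the dust itself. *)
Lemma potential_rec n z : potential n.+1 z =
  3 / 4 * \sum_(d : D) potential n (3 * (z - digit d)).
Proof.
rewrite /potential /= -mulrA mulrCA; congr (_ * _).
rewrite mulr_sumr; apply: eq_bigr => d _; rewrite -meanZ.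
apply: eq_mean => w _.
have -> : z - (digit d + 3^-1 * centre w) = 3^-1 * (3 * (z - digit d) - centre w).
  by field.
by rewrite invfM invrK.
Qed.

Lemma centre_away z w : 1 <= md z -> 1 / 5 <= md (z - centre w).
Proof. by have := modBge z (centre w); have := centre_le w; lra. Qed.

Lemma inv_diff (x y : C) : 1 / 5 <= md x -> 1 / 5 <= md y ->
  md (x^-1 - y^-1) <= 25 * md (x - y).
Proof.
move=> hx hy.
have x0 : 0 < md x by lra.
have y0 : 0 < md y by lra.
have xn0 : x != 0 by rewrite -mod_gt0.
have yn0 : y != 0 by rewrite -mod_gt0.
have -> : x^-1 - y^-1 = (y - x) / (x * y) by field; rewrite yn0.
rewrite modM modV modM modBC mulrC ler_wpM2r ?mod_ge0 // invf_ple ?posrE ?mulr_gt0 //.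
by nra.
Qed.

Lemma potential_lip n z z' : 1 <= md z -> 1 <= md z' ->
  md (potential n z - potential n z') <= 25 * md (z - z').
Proof.
move=> hz hz'; rewrite /potential -meanB; apply: mean_le => w _.
have := inv_diff (centre_away w hz) (centre_away w hz').
by have -> : z - centre w - (z' - centre w) = z - z' by ring.
Qed.

(** Passing to the next generation replaces a point charge by four at distance
    of order 3^-n, which is invisible at distance 1 up to order 3^-n. *)
Lemma potential_step n z : 1 <= md z ->
  md (potential n.+1 z - potential n z) <= 15 * 3^-1 ^+ n.
Proof.
move=> hz; rewrite {1}/potential mean_rcons /potential -meanB; apply: mean_le => w sw.
have -> : 4^-1 * (\sum_(d : D) (z - centre (rcons w d))^-1) - (z - centre w)^-1 =
   4^-1 * \sum_(d : D) ((z - centre (rcons w d))^-1 - (z - centre w)^-1).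
  rewrite sumrB mulrBr; congr (_ - _).
  by rewrite sumr_const card_D -(mulr_natl (_^-1)) mulKf // pnatr_eq0.
apply: mod_mean4 => d.
apply: (le_trans (inv_diff (centre_away _ hz) (centre_away _ hz))).
have -> : z - centre (rcons w d) - (z - centre w) = - (3^-1 ^+ n * digit d).
  by rewrite centre_rcons sw; ring.
rewrite modN modM mod3VX; have := digit_le d; have := pow3_gt0 n; nra.
Qed.

Lemma potential_le n z : 1 <= md z -> md (potential n z) <= 5.
Proof.
move=> hz; apply: mean_le => w _; rewrite modV.
have h := centre_away w hz.
by rewrite invf_ple ?posrE //; lra.
Qed.

(** Any constant above 2925 would do in [potential_circle]: each step adds at most
    3/4 * 3 * 65 / 3^n = 146.25 / 3^n, and 146.25 = 2925 * (4/5 - 3/4). *)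
Definition circle_const : R := 50 * 60.

Lemma circle_const_ge : 50 * 60 <= circle_const.
Proof. exact: lexx. Qed.

(** The key estimate near the dust.  By self-similarity the difference at
    generation n + 1 is 3/4 times the difference at generation n plus three
    differences of order 3^-n, taken at points of modulus at least 1, where the
    potentials converge geometrically.  Such a recursion decays like (4/5)^n. *)
Lemma potential_circle n w d z z' : size w = n ->
  md (z - centre w) = 3^-1 ^+ n -> md (z' - centre (rcons w d)) = 3^-1 ^+ n.+1 ->
  md (potential n.+1 z' - potential n z) <= circle_const * (4 / 5) ^+ n.
Proof.
have hK := circle_const_ge.
elim: n w z z' => [|n IH] w z z'.
  move=> /size0nil -> /=; rewrite subr0 !expr0 mulr0 addr0 expr1 => hz hz'.
  have h0 : md (potential 0 z) = 1 by rewrite /potential /= subr0 modV hz invr1.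
  suff h1 : md (potential 1 z') <= 3.
    by apply: (le_trans (modB _ _)); rewrite h0; lra.
  rewrite potential_rec modM.
  have -> : md (3 / 4) = 3 / 4 by rewrite modM modV !mod_nat.
  have h j : md (potential 0 (3 * (z' - digit j))) <= 1.
    rewrite /potential /= subr0 modV modM mod_nat invf_le1; last first.
      rewrite mulr_gt0 //; have [->|jd] := eqVneq j d; first by rewrite hz'; lra.
      have := modDist (digit j) z' (digit d); have := digit_sep jd.
      by rewrite hz' (modBC (digit j) z'); lra.
    have [->|jd] := eqVneq j d; first by rewrite hz'; lra.
    have := modDist (digit j) z' (digit d); have := digit_sep jd.
    by rewrite hz' (modBC (digit j) z'); lra.
  have : md (\sum_(j : D) potential 0 (3 * (z' - digit j))) <= \sum_(j : D) 1.
    by apply: (le_trans (mod_sum _ _ _)); apply: ler_sum.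
  by rewrite sumr_const card_D; lra.
case: w => // i w [sw] hz hz'.
pose x := 3 * (z - digit i); pose x' := 3 * (z' - digit i).
have hx : md (x - centre w) = 3^-1 ^+ n.
  have -> : x - centre w = 3 * (z - centre (i :: w)) by rewrite /x /=; field.
  by rewrite modM mod_nat hz exprS mulVKf.
have hx' : md (x' - centre (rcons w d)) = 3^-1 ^+ n.+1.
  have -> : x' - centre (rcons w d) = 3 * (z' - centre (rcons (i :: w) d)).
    by rewrite /x' /=; field.
  by rewrite modM mod_nat hz' (exprS _ n.+1) mulVKf.
have xle : md x <= 1.
  by have := centre_nested w; have := modD (x - centre w) (centre w);
    rewrite subrK hx sw; lra.
have xle' : md x' <= 1.
  have := centre_nested (rcons w d); have :=
    modD (x' - centre (rcons w d)) (centre (rcons w d)).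
  by rewrite subrK hx' size_rcons sw; lra.
have p0 := pow3_gt0 n.
have xx' : md (x' - x) <= 2 * 3^-1 ^+ n.
  have := modDist x' (centre (rcons w d)) x; rewrite hx'.
  have := modDist (centre (rcons w d)) (centre w) x; rewrite (modBC (centre w) x) hx.
  have -> : centre (rcons w d) - centre w = 3^-1 ^+ n * digit d
    by rewrite centre_rcons sw; ring.
  by rewrite modM mod3VX exprS; have := digit_le d; nra.
rewrite 2!potential_rec -mulrBr -sumrB (bigD1 i) //= -/x -/x'.
set S := \sum_(j | j != i) _.
have hS : md S <= 3 * (65 * 3^-1 ^+ n).
  have : md S <= \sum_(j : D | j != i) (65 * 3^-1 ^+ n).
    apply: (le_trans (mod_sum _ _ _)); apply: ler_sum => j ji.
    have sep := digit_sep ji.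
    have far (y y' : C) : md y <= 1 -> y = 3 * (y' - digit i) ->
      1 <= md (3 * (y' - digit j)).
      move=> y1 yE; have -> : 3 * (y' - digit j) = y - 3 * (digit j - digit i)
        by rewrite yE; ring.
      have := modBge (3 * (digit j - digit i)) y; rewrite modBC modM mod_nat; lra.
    have f1 := far x z xle erefl; have f2 := far x' z' xle' erefl.
    have := potential_step n f2; have := potential_lip n f2 f1.
    have -> : 3 * (z' - digit j) - 3 * (z - digit j) = x' - x by rewrite /x /x'; ring.
    have := modDist (potential n.+1 (3 * (z' - digit j))) (potential n (3 * (z' - digit
      j))) (potential n (3 * (z - digit j))).
    by lra.
  rewrite sumr_const.
  have -> : #|[pred j : D | j != i]| = 3%N.
    have := cardC1 i; rewrite card_D /= => <-.
    by apply: eq_card => j; rewrite !inE.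
  by rewrite -(mulr_natl (65 * 3^-1 ^+ n) 3).
have hI := IH w x x' sw hx hx'.
have h45 : 3^-1 ^+ n <= (4 / 5) ^+ n :> R.
  by apply: lerXn2r; rewrite ?nnegrE; lra.
rewrite modM.
have -> : md (3 / 4) = 3 / 4 by rewrite modM modV !mod_nat.
have hKX : 50 * 60 * (4 / 5) ^+ n <= circle_const * (4 / 5) ^+ n.
  by rewrite ler_wpM2r // exprn_ge0 //; lra.
have := modD (potential n.+1 x' - potential n x) S; rewrite (exprS (4 / 5) n).
by lra.
Qed.

End Dust.

(** * Limits of the potentials *)

Section Limits.
Variable R : realType.
Local Notation C := R[i].
Local Notation md := (@modulus R).
Local Notation circle_const := (circle_const R).
Local Notation centre := (@centre R).
Local Notation digit := (@digit R).
Notation D := (bool * bool)%type.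

(** The limit is the supremum of the lower bounds v n - B * rho ^+ n, which increase
    and stay below the decreasing upper bounds v n + B * rho ^+ n. *)
Lemma geo_lim_real (v : nat -> R) (B rho : R) : 0 <= B -> 0 <= rho ->
  (forall n, `|v n.+1 - v n| <= B * (1 - rho) * rho ^+ n) ->
  exists l, forall n, `|l - v n| <= B * rho ^+ n.
Proof.
move=> B0 rho0 step.
pose lo n := v n - B * rho ^+ n; pose hi n := v n + B * rho ^+ n.
have lohi n : lo n <= hi n.
  have : 0 <= B * rho ^+ n by rewrite mulr_ge0 ?exprn_ge0.
  by rewrite /lo /hi; lra.
have lo_mono n m : (n <= m)%N -> lo n <= lo m.
  move=> /subnK <-; elim: (m - n)%N => [|k IH] //; apply: (le_trans IH).
  by move: (step (k + n)%N); rewrite addSn /lo exprS ler_norml => /andP[? ?]; lra.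
have hi_mono n m : (n <= m)%N -> hi m <= hi n.
  move=> /subnK <-; elim: (m - n)%N => [|k IH] //; apply: le_trans IH.
  by move: (step (k + n)%N); rewrite addSn /hi exprS ler_norml => /andP[? ?]; lra.
have lh n m : lo n <= hi m.
  apply: (le_trans (lo_mono _ _ (leq_maxl n m))); apply: (le_trans (lohi _)).
  exact: hi_mono (leq_maxr n m).
have ubS : has_ubound (range lo) by exists (hi 0%N) => _ [n _ <-].
exists (sup (range lo)) => n; rewrite ler_norml; apply/andP; split.
  have : lo n <= sup (range lo) by apply: ub_le_sup => //; exists n.
  by rewrite /lo; lra.
have : sup (range lo) <= hi n.
  by apply: ge_sup; [exists (lo 0%N), 0%N | move=> _ [m _ <-]].
by rewrite /hi; lra.
Qed.

Lemma geo_lim (u : nat -> C) (B rho : R) : 0 <= B -> 0 <= rho ->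
  (forall n, md (u n.+1 - u n) <= B * (1 - rho) * rho ^+ n) ->
  exists l, forall n, md (l - u n) <= 2 * B * rho ^+ n.
Proof.
move=> B0 rho0 step.
have [|a Ha] := @geo_lim_real (fun n => complex.Re (u n)) B rho B0 rho0.
  by move=> n; rewrite -ReB (le_trans (Re_le_mod _)).
have [|b Hb] := @geo_lim_real (fun n => complex.Im (u n)) B rho B0 rho0.
  by move=> n; rewrite -ImB (le_trans (Im_le_mod _)).
exists (a +i* b)%C => n; apply: (le_trans (mod_le_ReIm _)).
by rewrite ReB ImB /=; have := Ha n; have := Hb n; lra.
Qed.

Lemma geo_lt (rho e : R) : 0 <= rho -> rho < 1 -> 0 < e -> exists n, rho ^+ n < e.
Proof.
move=> rho0 rho1 e0.
have h : `|rho| < 1 by rewrite ger0_norm.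
have [N _ HN] := @cvgr_lt R _ _ _ _ _ (cvg_expr h) e e0.
by exists N; apply: HN => /=.
Qed.

Lemma mod_small (z : C) (B rho : R) : 0 <= rho -> rho < 1 -> 0 <= B ->
  (forall n, md z <= B * rho ^+ n) -> z = 0.
Proof.
move=> rho0 rho1 B0 h; apply/eqP; rewrite -mod_eq0 eq_le mod_ge0 andbT.
rewrite leNgt; apply/negP => z0.
have B1 : 0 < B + 1 by lra.
have [n hn] := geo_lt rho0 rho1 (divr_gt0 z0 B1).
have := h n; move: hn; rewrite ltr_pdivlMr // => hn.
have : 0 <= rho ^+ n by rewrite exprn_ge0.
by nra.
Qed.

Lemma mkseq_head (s : nat -> D) n : mkseq s n.+1 = s 0%N :: mkseq (fun k => s k.+1) n.
Proof.
by rewrite /mkseq /= -[1%N]addn0 iotaDl -map_comp.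
Qed.

Lemma dust_exists : exists e : (nat -> D) -> C,
  forall s n, md (e s - centre (mkseq s n)) <= 2 * 3^-1 ^+ n.
Proof.
suff : forall s : nat -> D, exists l : C, forall n, md (l - centre (mkseq s n)) <= 2 *
  3^-1 ^+ n.
  move=> h; exists (fun s => projT1 (cid (h s))) => s; exact: (projT2 (cid (h s))).
move=> s; have [|||l Hl] := @geo_lim (fun n => centre (mkseq s n)) 1 3^-1 => //.
  move=> n; rewrite mkseqS centre_rcons size_mkseq.
  have -> : centre (mkseq s n) + 3^-1 ^+ n * digit (s n) - centre (mkseq s n) =
    3^-1 ^+ n * digit (s n) by ring.
  rewrite modM mod3VX; have := digit_le R (s n); have := pow3_gt0 R n; nra.
by exists l => n; have := Hl n; rewrite mulr1.
Qed.

Definition dust (s : nat -> D) : C := projT1 (cid dust_exists) s.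

Lemma dust_near s n : md (dust s - centre (mkseq s n)) <= 2 * 3^-1 ^+ n.
Proof. exact: (projT2 (cid dust_exists)). Qed.

Lemma third_ge0 : 0 <= 3^-1 :> R. Proof. lra. Qed.
Lemma third_lt1 : 3^-1 < 1 :> R. Proof. lra. Qed.

Lemma dust_cons s : dust s = digit (s 0%N) + 3^-1 * dust (fun k => s k.+1).
Proof.
apply/eqP; rewrite -subr_eq0; apply/eqP.
apply: (@mod_small _ 4 3^-1 third_ge0 third_lt1) => // n.
have := dust_near s n.+1; have := dust_near (fun k => s k.+1) n.
rewrite mkseq_head /= exprS.
set a := dust s; set b := dust _; set c := centre _ => h1 h2.
have -> : a - (digit (s 0%N) + 3^-1 * b) =
  (a - (digit (s 0%N) + 3^-1 * c)) - 3^-1 * (b - c) by ring.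
apply: (le_trans (modB _ _)); rewrite modM mod3V; have := pow3_gt0 R n; lra.
Qed.

Lemma dust_le s : md (dust s) <= 4 / 5.
Proof.
rewrite leNgt; apply/negP => h.
have e0 : 0 < (md (dust s) - 4 / 5) / 2 by lra.
have [n hn] := geo_lt third_ge0 third_lt1 e0.
have := dust_near s n; have := modBge (dust s) (centre (mkseq s n)); have :=
  centre_le R (mkseq s n); lra.
Qed.

(** The centre of each piece lies in a hole of the dust of comparable size; this
    porosity is what makes sharp peaking functions possible. *)
Lemma dust_away s w : 1 / 5 * 3^-1 ^+ size w <= md (dust s - centre w).
Proof.
elim: w s => [|d w IH] s /=.
  rewrite subr0 dust_cons; have := modDge (digit (s 0%N)) (3^-1 * dust (fun k => s k.+1)).
  rewrite modM mod3V; have := digit_ge R (s 0%N); have := dust_le (fun k => s k.+1).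
  by rewrite expr0; lra.
rewrite dust_cons; set s' := fun k => _.
have [->|sd] := eqVneq (s 0%N) d.
  have -> : digit d + 3^-1 * dust s' - (digit d + 3^-1 * centre w) =
    3^-1 * (dust s' - centre w) by ring.
  by rewrite modM mod3V exprS; have := IH s'; lra.
have := modBge (digit (s 0%N) - digit d) (3^-1 * (centre w - dust s')).
have -> : digit (s 0%N) - digit d - 3^-1 * (centre w - dust s') =
  digit (s 0%N) + 3^-1 * dust s' - (digit d + 3^-1 * centre w) by ring.
rewrite modM mod3V; have := modB (centre w) (dust s').
have := centre_le R w; have := dust_le s'; have := digit_sep R sd.
have := pow3_le1 R (size w); rewrite exprS; lra.
Qed.

(** Used contrapositively: nearby points have long common addresses, which makes
    functions of the address continuous on the dust. *)
Lemma dust_sep s t k n : (k < n)%N -> s k != t k ->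
  1 / 5 * 3^-1 ^+ n <= md (dust s - dust t).
Proof.
elim: n s t k => [//|n IH] s t k kn skt.
rewrite (dust_cons s) (dust_cons t); set s' := fun k => s _; set t' := fun k => t _.
have p1 := pow3_le1 R n; have p0 := pow3_gt0 R n.
have [e0|ne0] := eqVneq (s 0%N) (t 0%N).
  case: k kn skt => [|k] kn skt; first by rewrite e0 eqxx in skt.
  have := IH s' t' k kn skt; rewrite e0.
  have -> : digit (t 0%N) + 3^-1 * dust s' - (digit (t 0%N) + 3^-1 * dust t') =
    3^-1 * (dust s' - dust t') by ring.
  by rewrite modM mod3V exprS; lra.
have := modBge (digit (s 0%N) - digit (t 0%N)) (3^-1 * (dust t' - dust s')).
have -> : digit (s 0%N) - digit (t 0%N) - 3^-1 * (dust t' - dust s') =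
  digit (s 0%N) + 3^-1 * dust s' - (digit (t 0%N) + 3^-1 * dust t') by ring.
rewrite modM mod3V; have := modB (dust t') (dust s').
have := dust_le t'; have := dust_le s'; have := digit_sep R ne0.
by rewrite exprS; lra.
Qed.

Lemma dust_inj s t : dust s = dust t -> s = t.
Proof.
move=> e; apply/funext => k; apply/eqP; rewrite -[_ == _]negbK; apply/negP => ne.
have := dust_sep (ltnSn k) ne; rewrite e subrr mod0.
by have := pow3_gt0 R k.+1; lra.
Qed.

Lemma dust_common s t n : (forall k, (k < n)%N -> s k = t k) ->
  md (dust s - dust t) <= 4 * 3^-1 ^+ n.
Proof.
move=> st; have h : mkseq s n = mkseq t n.
  by apply/eq_in_map => k; rewrite mem_iota => /andP[_]; rewrite add0n => /st.
have := dust_near s n; have := dust_near t n; rewrite -h (modBC (dust t)).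
have := modDist (dust s) (centre (mkseq s n)) (dust t); lra.
Qed.

(** The dust is a product: real and imaginary parts are read off from separate
    components of the address. *)
Lemma centre_coordinates (s t : nat -> D) n :
  ((forall k, (s k).1 = (t k).1) -> complex.Re (centre (mkseq s n)) =
    complex.Re (centre (mkseq t n))) /\
  ((forall k, (s k).2 = (t k).2) -> complex.Im (centre (mkseq s n)) =
    complex.Im (centre (mkseq t n))).
Proof.
have e3 : (3^-1 : C) = (3^-1 : R)%:C%C by rewrite fmorphV /= rmorph_nat.
elim: n s t => [|n IH] s t //; rewrite !mkseq_head /=.
have [IH1 IH2] := IH (fun k => s k.+1) (fun k => t k.+1).
split=> st.
  by rewrite !ReD e3 !Re_scale IH1 // /digit /= st.
by rewrite !ImD e3 !Im_scale IH2 // /digit /= st.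
Qed.

Lemma Re_dust s t : (forall k, (s k).1 = (t k).1) -> complex.Re (dust s) =
  complex.Re (dust t).
Proof.
move=> st; apply/eqP; rewrite -subr_eq0; apply/eqP.
apply: (@complexI R); apply: (@mod_small _ 4 3^-1 third_ge0 third_lt1) => // n.
rewrite mod_real.
have := le_trans (Re_le_mod _) (dust_near s n); have :=
  le_trans (Re_le_mod _) (dust_near t n).
rewrite !ReB; have [-> // _] := centre_coordinates s t n.
by rewrite !ler_norml => /andP[h1 h2] /andP[h3 h4]; apply/andP; split; lra.
Qed.

Lemma Im_dust s t : (forall k, (s k).2 = (t k).2) -> complex.Im (dust s) =
  complex.Im (dust t).
Proof.
move=> st; apply/eqP; rewrite -subr_eq0; apply/eqP.
apply: (@complexI R); apply: (@mod_small _ 4 3^-1 third_ge0 third_lt1) => // n.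
rewrite mod_real.
have := le_trans (Im_le_mod _) (dust_near s n); have :=
  le_trans (Im_le_mod _) (dust_near t n).
rewrite !ImB; have [_ -> //] := centre_coordinates s t n.
by rewrite !ler_norml => /andP[h1 h2] /andP[h3 h4]; apply/andP; split; lra.
Qed.

Lemma Phi_exists : exists Phi : (nat -> D) -> C, forall s n z,
  md (z - centre (mkseq s n)) = 3^-1 ^+ n ->
    md (Phi s - potential n z) <= 40 * circle_const * (4 / 5) ^+ n.
Proof.
suff : forall s : nat -> D, exists l : C, forall n z,
  md (z - centre (mkseq s n)) = 3^-1 ^+ n ->
    md (l - potential n z) <= 40 * circle_const * (4 / 5) ^+ n.
  move=> h; exists (fun s => projT1 (cid (h s))) => s; exact: (projT2 (cid (h s))).
(* Any choice of points on the circles would do. *)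
move=> s; pose zz n : C := centre (mkseq s n) + 3^-1 ^+ n.
have hz n : md (zz n - centre (mkseq s n)) = 3^-1 ^+ n.
  by rewrite /zz addrAC subrr add0r mod3VX.
have step n z z' : md (z - centre (mkseq s n)) = 3^-1 ^+ n ->
    md (z' - centre (mkseq s n.+1)) = 3^-1 ^+ n.+1 ->
    md (potential n.+1 z' - potential n z) <= circle_const * (4 / 5) ^+ n.
  by rewrite mkseqS; apply: potential_circle; rewrite size_mkseq.
have [|||l Hl] := @geo_lim (fun n => potential n (zz n)) (5 * circle_const) (4 / 5).
- by have := circle_const_ge R; lra.
- by lra.
- move=> n; apply: (le_trans (step _ _ _ (hz n) (hz n.+1))).
  have : 0 <= (4 / 5 : R) ^+ n by rewrite exprn_ge0 //; lra.
  by lra.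
exists l => n z hzn.
have := step _ _ _ hzn (hz n.+1); have := step _ _ _ (hz n) (hz n.+1).
rewrite (modBC _ (potential n (zz n))) => h1 h2.
have := Hl n; have := modDist l (potential n (zz n)) (potential n z).
have := modDist (potential n (zz n)) (potential n.+1 (zz n.+1)) (potential n z).
have : 0 <= circle_const * (4 / 5 : R) ^+ n.
  by rewrite mulr_ge0 ?exprn_ge0 //; have := circle_const_ge R; lra.
by lra.
Qed.

(** The potential at the point of the dust with address [s].  It is defined through
    the circles around the pieces that contain this point, since the finite
    potentials need not be controlled at the point itself. *)
Definition Phi (s : nat -> D) : C := projT1 (cid Phi_exists) s.

Lemma Phi_near s n z : md (z - centre (mkseq s n)) = 3^-1 ^+ n ->
  md (Phi s - potential n z) <= 40 * circle_const * (4 / 5) ^+ n.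
Proof. exact: (projT2 (cid Phi_exists)). Qed.

Lemma Phi_common s t n : (forall k, (k < n)%N -> s k = t k) ->
  md (Phi s - Phi t) <= 80 * circle_const * (4 / 5) ^+ n.
Proof.
move=> st; have h : mkseq s n = mkseq t n.
  by apply/eq_in_map => k; rewrite mem_iota => /andP[_]; rewrite add0n => /st.
pose z : C := centre (mkseq s n) + 3^-1 ^+ n.
have hz : md (z - centre (mkseq s n)) = 3^-1 ^+ n by rewrite /z addrAC subrr add0r mod3VX.
have hz' := hz; rewrite h in hz'.
have := Phi_near hz; have := Phi_near hz'; rewrite (modBC (Phi t)).
have := modDist (Phi s) (potential n z) (Phi t); lra.
Qed.

Lemma far_potential_exists : exists G : C -> C, forall z n,
  1 <= md z -> md (G z - potential n z) <= 50 * 3^-1 ^+ n.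
Proof.
suff : forall z : C, exists l : C, forall n, 1 <= md z ->
  md (l - potential n z) <= 50 * 3^-1 ^+ n.
  move=> h; exists (fun s => projT1 (cid (h s))) => s; exact: (projT2 (cid (h s))).
move=> z; have [z1|z1] := leP 1 (md z); last by exists 0 => n z1'; lra.
have [|||l Hl] := @geo_lim (fun n => potential n z) 25 3^-1 => //.
- move=> n; apply: (le_trans (potential_step n z1)); have := pow3_gt0 R n; lra.
by exists l => n _; have := Hl n; lra.
Qed.

Definition far_potential (z : C) : C := projT1 (cid far_potential_exists) z.

Lemma far_potential_near z n : 1 <= md z ->
  md (far_potential z - potential n z) <= 50 * 3^-1 ^+ n.
Proof. exact: (projT2 (cid far_potential_exists)). Qed.

(** Lipschitz and affine estimates pass to the limit. *)
Lemma far_potential_limit (z z' c : C) (M : R) : 1 <= md z -> 1 <= md z' ->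
  (forall n, md (potential n z - potential n z' - c) <= M) ->
    md (far_potential z - far_potential z' - c) <= M.
Proof.
move=> hz hz' h; rewrite leNgt; apply/negP => lt.
have e0 : 0 < (md (far_potential z - far_potential z' - c) - M) / 200 by lra.
have [n hn] := geo_lt third_ge0 third_lt1 e0.
have := far_potential_near n hz; have := far_potential_near n hz'; have := h n;
  rewrite (modBC (far_potential z')).
set a := far_potential z in lt hn *; set b := far_potential z' in lt hn *; set x :=
  potential n z; set y := potential n z' => h1 h2 h3.
have := modD (a - x) (y - b); have := modD ((a - x) + (y - b)) (x - y - c).
have -> : (a - x) + (y - b) + (x - y - c) = a - b - c by ring.
by lra.
Qed.
End Limits.

(** * Runge approximation by pushing poles *)

Section Runge.
Variable R : realType.
Local Notation C := R[i].
Local Notation md := (@modulus R).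

Definition poly_approx (K : set C) (h : C -> C) :=
  forall e : R, 0 < e -> exists p : {poly C}, forall z, K z -> md (p.[z] - h z) <= e.

Lemma poly_approx_poly K (p : {poly C}) : poly_approx K (fun z => p.[z]).
Proof. by move=> e e0; exists p => z _; rewrite subrr mod0 ltW. Qed.

Lemma poly_approx_ext (K : set C) h g : (forall z, K z -> h z = g z) ->
  poly_approx K h -> poly_approx K g.
Proof. by move=> hg ah e /ah[p Hp]; exists p => z Kz; rewrite -hg //; exact: Hp. Qed.

Lemma poly_approx_mul (K : set C) h g (B : R) : 0 <= B ->
  (forall z, K z -> md (h z) <= B) -> (forall z, K z -> md (g z) <= B) ->
  poly_approx K h -> poly_approx K g -> poly_approx K (fun z => h z * g z).
Proof.
move=> B0 hB gB ah ag e e0.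
pose d := Num.min 1 (e / (2 * B + 1)).
have B1 : 0 < 2 * B + 1 by lra.
have d0 : 0 < d by rewrite lt_min ltr01 divr_gt0.
have d1 : d <= 1 by rewrite ge_min lexx.
have de : d * (2 * B + 1) <= e by rewrite -ler_pdivlMr // ge_min lexx orbT.
have [p Hp] := ah _ d0; have [q Hq] := ag _ d0.
exists (p * q) => z Kz; rewrite hornerM.
have -> : p.[z] * q.[z] - h z * g z =
  (p.[z] - h z) * (q.[z] - g z) + h z * (q.[z] - g z) + (p.[z] - h z) * g z by ring.
have h1 := Hp z Kz; have h2 := Hq z Kz; have h3 := hB z Kz; have h4 := gB z Kz.
have g1 := mod_ge0 (p.[z] - h z); have g2 := mod_ge0 (q.[z] - g z).
have g3 := mod_ge0 (h z); have g4 := mod_ge0 (g z).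
apply: (le_trans (modD _ _)); rewrite modM.
have := modD ((p.[z] - h z) * (q.[z] - g z)) (h z * (q.[z] - g z)); rewrite !modM.
have : md (p.[z] - h z) * md (q.[z] - g z) <= d * 1 by apply: ler_pM => //; lra.
have : md (h z) * md (q.[z] - g z) <= B * d by apply: ler_pM.
have : md (p.[z] - h z) * md (g z) <= d * B by apply: ler_pM.
lra.
Qed.

Lemma geo_sum (u : C) n : u != 1 ->
  \sum_(k < n) u ^+ k - (1 - u)^-1 = - (u ^+ n / (1 - u)).
Proof.
move=> u1; have u0 : 1 - u != 0 by rewrite subr_eq0 eq_sym.
have := subrX1 u n; rewrite -opprB -[u - 1]opprB mulNr => /oppr_inj h.
by apply: (mulIf u0); rewrite mulrBl mulrC -h mulVf // mulNr mulfVK //; ring.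
Qed.

(** The geometric series in a polynomial close to [u]. *)
Lemma poly_approx_inv (K : set C) u : (forall z, K z -> md (u z) <= 1 / 2) ->
  poly_approx K u -> poly_approx K (fun z => (1 - u z)^-1).
Proof.
move=> u2 au e e0.
pose d := Num.min (1 / 4) (e / 16).
have d0 : 0 < d by rewrite lt_min; apply/andP; split; lra.
have d1 : d <= 1 / 4 by rewrite ge_min lexx.
have de : d <= e / 16 by rewrite ge_min lexx orbT.
have [p Hp] := au _ d0.
have [n hn] : exists n, (3 / 4 : R) ^+ n < e / 8 by apply: geo_lt; lra.
exists (\sum_(k < n) p ^+ k) => z Kz.
rewrite horner_sum; under eq_bigr do rewrite horner_exp.
have h1 := Hp z Kz; have h2 := u2 z Kz.
set v := p.[z] in h1 *; set w := u z in h1 h2 *.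
have v34 : md v <= 3 / 4 by have := modD (v - w) w; rewrite subrK; lra.
have a1 : 1 / 4 <= md (1 - v) by have := modBge 1 v; rewrite mod1; lra.
have a2 : 1 / 2 <= md (1 - w) by have := modBge 1 w; rewrite mod1; lra.
have n1 : 1 - v != 0 by rewrite -mod_gt0; lra.
have n2 : 1 - w != 0 by rewrite -mod_gt0; lra.
have v1 : v != 1 by rewrite eq_sym -subr_eq0.
have := geo_sum n v1; set S := \sum_(k < n) _ => hS.
have -> : S - (1 - w)^-1 = (v - w) / ((1 - v) * (1 - w)) - v ^+ n / (1 - v).
  have -> : S = (1 - v)^-1 - v ^+ n / (1 - v) by rewrite -hS; ring.
  by field; rewrite n1 n2.
apply: (le_trans (modB _ _)); rewrite !modM !modV modM modX.
have p34 : md v ^+ n <= (3 / 4) ^+ n by apply: lerXn2r; rewrite ?nnegrE ?mod_ge0 //; lra.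
have q1 : md (v - w) / (md (1 - v) * md (1 - w)) <= e / 2.
  rewrite ler_pdivrMr ?mulr_gt0 //; [|lra|lra].
  have : 1 / 4 * (1 / 2) <= md (1 - v) * md (1 - w) by apply: ler_pM => //; lra.
  by nra.
have q2 : md v ^+ n / md (1 - v) <= e / 2.
  rewrite ler_pdivrMr; last lra.
  by nra.
lra.
Qed.

(** Here 1 / (z - c) is 1 / (z - c') divided by 1 - (c - c') / (z - c'), and the
    last quotient is at most 1/2 on K. *)
Lemma push_pole (K : set C) (c c' : C) (d : R) : 0 < d ->
  (forall z, K z -> d <= md (z - c')) ->
  2 * md (c - c') <= d ->
  poly_approx K (fun z => (z - c')^-1) -> poly_approx K (fun z => (z - c)^-1).
Proof.
move=> d0 hd cc ac'.
have zc z : K z -> z - c' != 0 by move=> /hd h; rewrite -mod_gt0; lra.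
have f_le z : K z -> md (z - c')^-1 <= d^-1.
  move=> /hd h; rewrite modV lef_pV2 ?posrE //; lra.
pose u z := (c - c') * (z - c')^-1.
have u2 z : K z -> md (u z) <= 1 / 2.
  move=> Kz; have := f_le _ Kz; rewrite /u modM => h.
  have : md (c - c') * md (z - c')^-1 <= (d / 2) * d^-1 by apply: ler_pM;
    rewrite ?mod_ge0 //; lra.
  by rewrite -mulrA [2^-1 * _]mulrC mulrA divff ?gt_eqF //; lra.
have au : poly_approx K u.
  pose B := Num.max (md (c - c')) d^-1.
  apply: (@poly_approx_mul K (fun=> c - c') (fun z => (z - c')^-1) B) => //.
  - by rewrite le_max mod_ge0.
  - by move=> z _; rewrite le_max lexx.
  - by move=> z /f_le h; rewrite le_max h orbT.
  - apply: (@poly_approx_ext K (fun z => (c - c')%:P.[z])); last exact: poly_approx_poly.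
    by move=> z _; rewrite hornerC.
have a1 z : K z -> md (1 - u z)^-1 <= 2.
  move=> Kz; rewrite modV invf_ple ?posrE //.
    by have := modBge 1 (u z); have := u2 z Kz; rewrite mod1; lra.
  by have := modBge 1 (u z); have := u2 z Kz; rewrite mod1; lra.
pose B := Num.max 2 d^-1.
have := @poly_approx_mul K (fun z => (z - c')^-1) (fun z => (1 - u z)^-1) B.
move=> /(_ _ _ _ ac' (poly_approx_inv u2 au)) H.
apply: poly_approx_ext (H _ _ _).
- move=> z Kz; have zn := zc z Kz; have := a1 z Kz.
  rewrite -invfM /u mulrBr mulr1 mulrCA divff // mulr1 => _; congr (_^-1); ring.
- by rewrite le_max ler0n.
- by move=> z /f_le h; rewrite le_max h orbT.
- by move=> z /a1 h; rewrite le_max h.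
Qed.

Lemma far_pole (K : set C) (c : C) (B : R) : 0 < B -> (forall z, K z -> md z <= B) ->
  2 * B <= md c -> poly_approx K (fun z => (z - c)^-1).
Proof.
move=> B0 hB cB.
have c0 : c != 0 by rewrite -mod_gt0; lra.
pose u z := c^-1 * z.
have u2 z : K z -> md (u z) <= 1 / 2.
  move=> /hB h; rewrite /u modM modV mulrC ler_pdivrMr ?mod_gt0 //; lra.
have au : poly_approx K u.
  apply: (@poly_approx_ext K (fun z => (c^-1 *: 'X).[z])); last exact: poly_approx_poly.
  by move=> z _; rewrite hornerZ hornerX.
have a1 z : K z -> md (1 - u z)^-1 <= 2.
  move=> Kz; have := modBge 1 (u z); have := u2 z Kz; rewrite mod1 => h1 h2.
  by rewrite modV invf_ple ?posrE //; lra.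
pose b := Num.max 2 (md (- c^-1)).
apply: (@poly_approx_ext K (fun z => - c^-1 * (1 - u z)^-1)).
  move=> z Kz; rewrite mulNr -invfM -invrN; congr (_^-1).
  by rewrite /u; field.
apply: (@poly_approx_mul K (fun=> - c^-1) _ b) => //.
- by rewrite le_max ler0n.
- by move=> z _; rewrite le_max lexx orbT.
- by move=> z /a1 h; rewrite le_max h.
- apply: (@poly_approx_ext K (fun z => (- c^-1)%:P.[z])); last exact: poly_approx_poly.
  by move=> z _; rewrite hornerC.
- exact: poly_approx_inv.
Qed.

(** A bilipschitz map carries the ray a + t u to a path that keeps a definite
    distance from K and goes to infinity.  Starting from a pole beyond a large
    disc, the pole is pushed back along this path in small equal steps. *)
Lemma runge_ray (K E : set C) (psi : C -> C) (m M B : R) (a u : C) (d : R) :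
  0 < m -> 0 < M -> 0 < B -> 0 < d ->
  (forall z w, m * md (z - w) <= md (psi z - psi w)) ->
  (forall z w, md (psi z - psi w) <= M * md (z - w)) ->
  (forall z, K z -> exists2 x, E x & z = psi x) -> (forall z, K z -> md z <= B) ->
  md u = 1 -> (forall t : R, 0 <= t -> forall x, E x -> d <= md (a + t%:C%C * u - x)) ->
  poly_approx K (fun z => (z - psi a)^-1).
Proof.
move=> m0 M0 B0 d0 lo hi KE KB u1 ray.
(* With this step the image of the ray moves by at most half its distance to K. *)
pose tau := m * d / (2 * M).
have tau0 : 0 < tau by rewrite /tau divr_gt0 // mulr_gt0.
pose t k : R := k%:R * tau.
have t0 k : 0 <= t k by rewrite mulr_ge0 ?ler0n // ltW.
pose c k := psi (a + (t k)%:C%C * u).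
have far k z : K z -> m * d <= md (z - c k).
  move=> /KE[x Ex ->]; apply: le_trans (lo _ _).
  by rewrite ler_pM2l // modBC; apply: ray.
have near k : 2 * md (c k - c k.+1) <= m * d.
  have := hi (a + (t k)%:C%C * u) (a + (t k.+1)%:C%C * u).
  have -> : a + (t k)%:C%C * u - (a + (t k.+1)%:C%C * u) = - (tau%:C%C * u).
    have -> : t k.+1 = t k + tau by rewrite /t mulrSr mulrDl mul1r.
    by rewrite rmorphD /=; ring.
  rewrite modN modM u1 mulr1 mod_real gtr0_norm // -/(c k) -/(c k.+1).
  have -> : M * tau = m * d / 2 by rewrite /tau; field; rewrite gt_eqF.
  lra.
have apxS k : poly_approx K (fun z => (z - c k.+1)^-1) ->
  poly_approx K (fun z => (z - c k)^-1).
  by apply: (push_pole (mulr_gt0 m0 d0)) => //; exact: far.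
have apxN k : poly_approx K (fun z => (z - c k)^-1) ->
  poly_approx K (fun z => (z - c 0%N)^-1).
  by elim: k => [|k IH] // h; apply: IH; apply: apxS.
have <- : c 0%N = psi a by rewrite /c /t mul0r mul0r addr0.
pose L := (2 * B + md (psi a)) / (m * tau).
have [n hn] : exists n, L <= n%:R.
  by exists (Num.truncn L).+1; rewrite ltW // Num.Theory.truncnS_gt.
apply: (apxN n); apply: (far_pole B0 KB).
have := lo (a + (t n)%:C%C * u) a.
have -> : a + (t n)%:C%C * u - a = (t n)%:C%C * u by ring.
rewrite modM u1 mulr1 mod_real ger0_norm // -/(c n).
move: hn; rewrite ler_pdivrMr; last exact: mulr_gt0.
have := modB (c n) (psi a); rewrite /t; lra.
Qed.
End Runge.

(** * The reflected potential near the dust *)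

Section Psi.
Variable R : realType.
Local Notation C := R[i].
Local Notation md := (@modulus R).
Local Notation centre := (@centre R).
Local Notation digit := (@digit R).
Notation D := (bool * bool)%type.

(** Retraction onto an interval; [clampC] extends functions given near the dust
    to the plane without increasing Lipschitz constants. *)
Definition clamp (x : R) : R := Num.max (- (4 / 5)) (Num.min x (4 / 5)).
Definition clampC (z : C) : C := (clamp (complex.Re z) +i* clamp (complex.Im z))%C.

Lemma clamp_lip x y : `|clamp x - clamp y| <= `|x - y|.
Proof.
wlog xy : x y / x <= y.
  by move=> H; have [/H//|/ltW/H] := leP x y; rewrite distrC [X in _ <= X -> _]distrC.
have : `|x - y| = y - x by rewrite distrC ger0_norm ?subr_ge0.
move=> ->; rewrite /clamp; have [a1|a1] := leP x (4 / 5); have [a2|a2] := leP y (4 / 5).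
- by have [b1|b1] := leP (- (4 / 5)) x; have [b2|b2] := leP (- (4 / 5)) y;
  rewrite ler_norml; apply/andP; split; lra.
- by have [b1|b1] := leP (- (4 / 5)) x; have [b2|b2] := leP (- (4 / 5)) (4 / 5 : R);
  rewrite ler_norml; apply/andP; split; lra.
- by lra.
- by rewrite subrr normr0 subr_ge0.
Qed.

Lemma clamp_le x : `|clamp x| <= 4 / 5.
Proof.
rewrite /clamp; have [a1|a1] := leP x (4 / 5).
  by have [b1|b1] := leP (- (4 / 5)) x; rewrite ler_norml; apply/andP; split; lra.
by have [b1|b1] := leP (- (4 / 5)) (4 / 5 : R); rewrite ler_norml; apply/andP; split; lra.
Qed.

Lemma clamp_id x : `|x| <= 4 / 5 -> clamp x = x.
Proof.
rewrite ler_norml => /andP[h1 h2]; rewrite /clamp.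
by have [a1|a1] := leP x (4 / 5); [have [b1|b1] := leP (- (4 / 5)) x; lra | lra].
Qed.

Lemma clampC_lip z w : md (clampC z - clampC w) <= md (z - w).
Proof.
have sq (x y : R) : `|x| <= `|y| -> x ^+ 2 <= y ^+ 2.
  move=> xy; rewrite -[leLHS]real_normK ?num_real // -[leRHS]real_normK ?num_real //.
  by apply: lerXn2r; rewrite ?nnegrE.
rewrite !modE; apply: ler_wsqrtr; apply: lerD; apply: sq.
  by rewrite !ReB; exact: clamp_lip.
by rewrite !ImB; exact: clamp_lip.
Qed.

Lemma clampC_le z : md (clampC z) <= 8 / 5.
Proof.
apply: (le_trans (mod_le_ReIm _)); rewrite /=.
have := clamp_le (complex.Re z); have := clamp_le (complex.Im z); lra.
Qed.

Lemma clampC_id z : md z <= 4 / 5 -> clampC z = z.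
Proof.
move=> h; rewrite /clampC !clamp_id; first by case: (z).
  exact: le_trans (Im_le_mod _) h.
exact: le_trans (Re_le_mod _) h.
Qed.

Lemma mean_cst n (c : C) : mean n (fun=> c) = c.
Proof.
elim: n => [|n IH] //=; rewrite (eq_bigr (fun=> c)); last by move=> d _; exact: IH.
by rewrite sumr_const card_D -(mulr_natl c) mulKf // pnatr_eq0.
Qed.

Lemma far20 (z : C) : md z <= 8 / 5 -> 1 <= md (20 - z).
Proof. by move=> h; have := modBge 20 z; rewrite mod_nat; lra. Qed.

Lemma mod400V : md (20 * 20)^-1 = (20 * 20)^-1.
Proof. by rewrite modV modM mod_nat. Qed.

(** To first order 1 / (20 - z - t) is 1/20 + (z + t) / 20^2; at the distance 20
    the error has Lipschitz constant at most half of the slope. *)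
Lemma far_potential_affine (z w : C) : md z <= 8 / 5 -> md w <= 8 / 5 ->
  md (far_potential (20 - z) - far_potential (20 - w) - (z - w) / (20 * 20)) <= 1 / 2 *
    md (z - w) / (20 * 20).
Proof.
move=> hz hw; apply: far_potential_limit; [exact: far20|exact: far20|] => n.
rewrite /potential -meanB -[X in mean _ _ - X](mean_cst n) -meanB; apply: mean_le => v _.
have hv := centre_le R v.
set t := z + centre v; set s := w + centre v.
have ht : md t <= 12 / 5 by have := modD z (centre v); rewrite -/t; lra.
have hs : md s <= 12 / 5 by have := modD w (centre v); rewrite -/s; lra.
have t1 : 17 <= md (20 - t) by have := modBge 20 t; rewrite mod_nat; lra.
have s1 : 17 <= md (20 - s) by have := modBge 20 s; rewrite mod_nat; lra.
have t0 : 20 - t != 0 by rewrite -mod_gt0; lra.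
have s0 : 20 - s != 0 by rewrite -mod_gt0; lra.
have -> : (20 - z - centre v)^-1 - (20 - w - centre v)^-1 - (z - w) / (20 * 20) =
  (z - w) / (20 * 20) * ((20 * (t + s) - t * s) / ((20 - t) * (20 - s))).
  have -> : 20 - z - centre v = 20 - t by rewrite /t; ring.
  have -> : 20 - w - centre v = 20 - s by rewrite /s; ring.
  have -> : z - w = t - s by rewrite /t /s; ring.
  by field; rewrite t0 s0.
rewrite (modM ((z - w) / _)) (modM (z - w)) mod400V.
have q : md ((20 * (t + s) - t * s) / ((20 - t) * (20 - s))) <= 1 / 2.
  rewrite modM modV ler_pdivrMr; last by rewrite mod_gt0 mulf_neq0.
  rewrite modM; have : 17 * 17 <= md (20 - t) * md (20 - s) by apply: ler_pM; lra.
  have := modB (20 * (t + s)) (t * s); rewrite !modM mod_nat; have := modD t s.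
  have : md t * md s <= 12 / 5 * (12 / 5) by apply: ler_pM; rewrite ?mod_ge0.
  lra.
have := mod_ge0 (z - w); move: q; set Q := md (_ / _); nra.
Qed.

(** The deviation of the normalised reflected potential from the identity. *)
Definition kappa (z : C) : C :=
  20 * 20 * (far_potential (20 - clampC z) - 20^-1) - clampC z.

Lemma kappa_lip z w : md (kappa z - kappa w) <= 1 / 2 * md (z - w).
Proof.
have := far_potential_affine (clampC_le z) (clampC_le w).
have := clampC_lip z w.
set z' := clampC z; set w' := clampC w; move=> h1 h2.
have -> : kappa z - kappa w =
  20 * 20 * (far_potential (20 - z') - far_potential (20 - w') - (z' - w') / (20 * 20)).
  by rewrite /kappa -/z' -/w'; field.
by rewrite modM modM mod_nat; lra.
Qed.

(** On the dust this is the reflected potential; the extension through [clampC] is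
    the identity up to a contraction, followed by an affine map. *)
Definition psi (z : C) : C := 20^-1 + (z + kappa z) / (20 * 20).

Lemma psi_diff z w : psi z - psi w = (z - w + (kappa z - kappa w)) / (20 * 20).
Proof. by rewrite /psi; field. Qed.

Lemma psi_lo z w : 1 / (2 * 20 * 20) * md (z - w) <= md (psi z - psi w).
Proof.
rewrite psi_diff modM mod400V.
have := modDge (z - w) (kappa z - kappa w); have := kappa_lip z w; lra.
Qed.

Lemma psi_hi z w : md (psi z - psi w) <= 3 / (2 * 20 * 20) * md (z - w).
Proof.
rewrite psi_diff modM mod400V.
have := modD (z - w) (kappa z - kappa w); have := kappa_lip z w; lra.
Qed.

(** A preimage of c is a fixed point of the contraction
    z |-> 20^2 (c - 1/20) - kappa z. *)
Lemma psi_surj c : exists z, psi z = c.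
Proof.
pose T z := 20 * 20 * (c - 20^-1) - kappa z.
pose u n := iter n T 0.
have uS n : u n.+1 = 20 * 20 * (c - 20^-1) - kappa (u n) by [].
have [|||l Hl] := @geo_lim R u (2 * md (u 1%N - u 0%N)) (1 / 2).
- by rewrite mulr_ge0 ?mod_ge0.
- by lra.
- elim=> [|n IH]; first by rewrite expr0; lra.
  rewrite (uS n.+1) (uS n).
  have -> : 20 * 20 * (c - 20^-1) - kappa (u n.+1) - (20 * 20 * (c - 20^-1) - kappa (u
    n)) =
     kappa (u n) - kappa (u n.+1) by ring.
  have := kappa_lip (u n) (u n.+1); rewrite (modBC (u n)) exprS; lra.
exists l; apply/eqP; rewrite -subr_eq0; apply/eqP.
have h0 : 0 <= md (u 1%N - u 0%N) by exact: mod_ge0.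
apply: (@mod_small R _ (8 * md (u 1%N - u 0%N)) (1 / 2)); [lra|lra|lra|move=> n].
have -> : psi l - c = ((l - u n.+1) + (kappa l - kappa (u n))) / (20 * 20).
  by rewrite uS /psi; field.
rewrite modM modV modM mod_nat.
have := modD (l - u n.+1) (kappa l - kappa (u n)); have := kappa_lip l (u n).
have := Hl n; have := Hl n.+1; rewrite exprS; have := mod_ge0 (l - u n); lra.
Qed.

Lemma psi_dust (s : nat -> D) : psi (dust R s) = far_potential (20 - dust R s).
Proof. by rewrite /psi /kappa clampC_id ?dust_le //; field. Qed.

Definition Psi (s : nat -> D) : C := psi (dust R s).

Lemma Psi_inj s t : Psi s = Psi t -> s = t.
Proof.
move=> e; apply: (@dust_inj R); apply/eqP; rewrite -subr_eq0 -mod_eq0.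
have := psi_lo (dust R s) (dust R t); rewrite -/(Psi s) -/(Psi t) e subrr mod0.
have := mod_ge0 (dust R s - dust R t); rewrite eq_le => h0 h1.
by apply/andP; split; lra.
Qed.

Lemma Psi_common s t n : (forall k, (k < n)%N -> s k = t k) ->
  md (Psi s - Psi t) <= 3^-1 ^+ n.
Proof.
move=> /(@dust_common R); have := psi_hi (dust R s) (dust R t);
  rewrite -/(Psi s) -/(Psi t).
have := pow3_gt0 R n; lra.
Qed.

Lemma Psi_neq0 s : Psi s != 0.
Proof.
have h : md (dust R s) <= 8 / 5 by have := dust_le R s; lra.
have e0 : 0 < 1 / (50 * 50) :> R by lra.
have [n hn] := geo_lt (third_ge0 R) (third_lt1 R) e0.
rewrite -mod_gt0 /Psi psi_dust; have := far_potential_near n (far20 h).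
have : md (potential n (20 - dust R s) - 20^-1) <= 1 / 100.
  rewrite /potential -[X in mean _ _ - X](mean_cst n) -meanB; apply: mean_le => w _.
  have h1 := modBge (20 - dust R s) (centre w); have h2 := modBge 20 (dust R s).
  have := centre_le R w; have := dust_le R s; rewrite mod_nat in h2 => h3 h4.
  have n0 : 20 - dust R s - centre w != 0 by rewrite -mod_gt0; lra.
  have -> : (20 - dust R s - centre w)^-1 - 20^-1 =
    (dust R s + centre w) / (20 * (20 - dust R s - centre w)).
    by field.
  rewrite modM modV modM mod_nat ler_pdivrMr; last lra.
  have := modD (dust R s) (centre w); lra.
have := modDist 20^-1 (potential n (20 - dust R s)) (far_potential (20 - dust R s)).
have := modBge 20^-1 (20^-1 - far_potential (20 - dust R s)).
have -> : 20^-1 - (20^-1 - far_potential (20 - dust R s)) =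
  far_potential (20 - dust R s) by ring.
rewrite modV mod_nat (modBC (potential n _) 20^-1) (modBC (far_potential _)); lra.
Qed.

Lemma Psi_bounded s : md (Psi s) <= 55.
Proof.
have h : md (dust R s) <= 8 / 5 by have := dust_le R s; lra.
rewrite /Psi psi_dust; have := far_potential_near 0 (far20 h); have :=
  potential_le 0 (far20 h).
have := modD (far_potential (20 - dust R s) - potential 0 (20 - dust R s)) (potential 0
  (20 - dust R s)).
by rewrite subrK expr0; lra.
Qed.

Lemma Phi_bounded (s : nat -> D) : md (Phi R s) <= 40 * circle_const R + 1.
Proof.
have h : md (1 - centre (mkseq s 0)) = 3^-1 ^+ 0 by rewrite /= subr0 mod1 expr0.
have F0 : potential 0 (1 : C) = 1 by rewrite /potential /= subr0 invr1.
have := Phi_near h; rewrite expr0 F0.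
by have := modD (Phi R s - 1) 1; rewrite subrK mod1; lra.
Qed.

End Psi.

(** * Polynomials in several variables and convexity of graphs *)

Section PolyEval.
Variables (R : realType) (N : nat).
Local Notation C := R[i].
Local Notation md := (@modulus R).
Implicit Types (z w : 'rV[C]_N) (p q : mpoly.mpoly N C).

Lemma poly_eval0 z : poly_eval 0 z = 0.
Proof. exact: mpoly.meval0. Qed.

Lemma poly_evalC c z : poly_eval (mpoly.mpolyC N c) z = c.
Proof. exact: mpoly.mevalC. Qed.

Lemma poly_evalD p q z : poly_eval (p + q) z = poly_eval p z + poly_eval q z.
Proof. exact: mpoly.mevalD. Qed.

Lemma poly_evalM p q z : poly_eval (p * q) z = poly_eval p z * poly_eval q z.
Proof. exact: mpoly.mevalM. Qed.

Lemma poly_evalX (j : 'I_N) z : poly_eval (mpoly.mpolyX C (mpoly.mnm1 j)) z = z 0 j.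
Proof. exact: mpoly.mevalXU. Qed.

(** Induction over the ring operations, for properties of polynomial functions. *)
Lemma poly_eval_ind (Q : ('rV[C]_N -> C) -> Prop) :
  (forall c, Q (fun=> c)) -> (forall j, Q (fun z => z 0 j)) ->
  (forall f g, Q f -> Q g -> Q (fun z => f z + g z)) ->
  (forall f g, Q f -> Q g -> Q (fun z => f z * g z)) ->
  forall p, Q (poly_eval p).
Proof.
move=> Qc Qx QD QM p.
have -> : poly_eval p = fun z => \sum_(m <- mpoly.msupp p) mpoly.mcoeff m p *
    \prod_(i < N) z 0 i ^+ m i.
  by apply/funext => z; rewrite /poly_eval mpoly.mevalE.
have Qprod (m : mpoly.multinom N) : Q (fun z => \prod_(i < N) z 0 i ^+ m i).
  elim: (index_enum _) => [|i s IH].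
    by have -> : (fun z => \prod_(i <- [::]) z 0 i ^+ m i) = (fun=> 1)
      by apply/funext => z; rewrite big_nil.
  have -> : (fun z => \prod_(i <- i :: s) z 0 i ^+ m i) =
    (fun z => z 0 i ^+ m i * \prod_(i <- s) z 0 i ^+ m i) by apply/funext => z;
      rewrite big_cons.
  apply: (QM) => //; elim: (m i) => [|k IHk].
    by have -> : (fun z => z 0 i ^+ 0) = (fun=> 1) by apply/funext => z; rewrite expr0.
  have -> : (fun z => z 0 i ^+ k.+1) = (fun z => z 0 i * z 0 i ^+ k)
    by apply/funext => z; rewrite exprS.
  exact: QM.
elim: (mpoly.msupp p) => [|m s IH].
  by have -> : (fun z => \sum_(m <- [::]) mpoly.mcoeff m p * \prod_(i < N) z 0 i ^+ m
    i) = (fun=> 0)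
    by apply/funext => z; rewrite big_nil.
have -> : (fun z => \sum_(m <- m :: s) mpoly.mcoeff m p * \prod_(i < N) z 0 i ^+ m i) =
  (fun z => mpoly.mcoeff m p * \prod_(i < N) z 0 i ^+ m i +
     \sum_(m <- s) mpoly.mcoeff m p * \prod_(i < N) z 0 i ^+ m i).
  by apply/funext => z; rewrite big_cons.
by apply: (QD) => //; apply: (QM).
Qed.

Lemma uni_poly (j : 'I_N) (p : {poly C}) :
  exists P : mpoly.mpoly N C, forall z, poly_eval P z = p.[z 0 j].
Proof.
elim/poly_ind: p => [|p c [P HP]].
  by exists 0 => z; rewrite poly_eval0 horner0.
exists (P * mpoly.mpolyX C (mpoly.mnm1 j) + mpoly.mpolyC N c) => z.
by rewrite poly_evalD poly_evalM poly_evalX poly_evalC HP hornerMXaddC.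
Qed.

Lemma poly_eval_lip (W : R) p : exists B, forall z w (e : R),
  (forall j, md (z 0 j) <= W) -> (forall j, md (w 0 j) <= W) ->
  (forall j, md (z 0 j - w 0 j) <= e) -> 0 <= e ->
  md (poly_eval p z) <= B /\ md (poly_eval p z - poly_eval p w) <= B * e.
Proof.
pose Q (f : 'rV[C]_N -> C) := exists B : R, forall z w (e : R),
  (forall j, md (z 0 j) <= W) -> (forall j, md (w 0 j) <= W) ->
  (forall j, md (z 0 j - w 0 j) <= e) -> 0 <= e ->
    md (f z) <= B /\ md (f z - f w) <= B * e.
apply: (@poly_eval_ind Q) => [c|j|f g [B1 H1] [B2 H2]|f g [B1 H1] [B2 H2]].
- by exists (md c) => z w e _ _ _ e0; split => //; rewrite subrr mod0 mulr_ge0 ?mod_ge0.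
- exists (Num.max W 1) => z w e hz hw hzw e0; split; first by rewrite le_max hz.
  by apply: (le_trans (hzw j)); rewrite ler_peMl // le_max lexx orbT.
- exists (B1 + B2) => z w e hz hw hzw e0.
  have [h1 h2] := H1 _ _ _ hz hw hzw e0; have [h3 h4] := H2 _ _ _ hz hw hzw e0.
  split; first by have := modD (f z) (g z); lra.
  have := modD (f z - f w) (g z - g w).
  have -> : f z - f w + (g z - g w) = f z + g z - (f w + g w) by ring.
  lra.
exists (B1 * B2 * 2 + B1 * B2) => z w e hz hw hzw e0.
have hwz j : md (w 0 j - z 0 j) <= e by rewrite modBC.
have [h1 h2] := H1 _ _ _ hz hw hzw e0; have [h3 h4] := H2 _ _ _ hz hw hzw e0.
have [h5 h6] := H2 _ _ _ hw hz hwz e0.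
have p1 := mod_ge0 (f z); have p2 := mod_ge0 (g z); have p3 := mod_ge0 (g w).
have B10 : 0 <= B1 by lra.
have B20 : 0 <= B2 by lra.
have B12 : 0 <= B1 * B2 by exact: mulr_ge0.
split.
  rewrite modM; have : md (f z) * md (g z) <= B1 * B2 by apply: ler_pM.
  lra.
have -> : f z * g z - f w * g w = f z * (g z - g w) + (f z - f w) * g w by ring.
apply: (le_trans (modD _ _)); rewrite !modM.
have : md (f z) * md (g z - g w) <= B1 * (B2 * e) by apply: ler_pM; rewrite ?mod_ge0.
have : md (f z - f w) * md (g w) <= (B1 * e) * B2 by apply: ler_pM; rewrite ?mod_ge0.
have : 0 <= B1 * B2 * e by exact: mulr_ge0.
lra.
Qed.

End PolyEval.

Section Graph.
Variable R : realType.
Local Notation C := R[i].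
Local Notation md := (@modulus R).

(** Let z be outside the graph and let a be its j-th coordinate.  If a is not in
    the projection, 1 - (z_j - a) q(z_j) with q close to 1 / (z_j - a)
    separates z.  If a is the projection of the point pt i1, the polynomial
    (z_k - v0) (a - c) q(z_j), with v0 the k-th coordinate of pt i1 and q close to
    1 / (z_j - c), does: its modulus is about |z_k - v0| at z, while on the
    graph it is small since the function peaks at a, where the k-th coordinate
    is close to v0. *)
Lemma polynomially_convex_graph (T : Type) (pt : T ->
  'rV[C]_2) (j k : 'I_2) (i0 : T) (W : R) :
  (forall z w : 'rV[C]_2, z 0 j = w 0 j -> z 0 k = w 0 k -> z = w) ->
  (forall i l, md (pt i 0 l) <= W) ->
  (forall a, (forall i, pt i 0 j != a) ->
     poly_approx (range (fun i => pt i 0 j)) (fun z => (z - a)^-1)) ->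
  (forall i0 (e : R), 0 < e -> exists c,
     [/\ poly_approx (range (fun i => pt i 0 j)) (fun z => (z - c)^-1),
         c != pt i0 0 j &
         forall i, md ((pt i0 0 j - c) / (pt i 0 j - c)) * md (pt i 0 k - pt i0 0 k) <=
           e]) ->
  polynomially_convex (range pt).
Proof.
move=> ext bnd out peak.
have W0 : 0 <= W by apply: le_trans (bnd i0 j); exact: mod_ge0.
apply/seteqP; split => z; last first.
  move=> [i _ <-] p; apply: ub_le_sup; last by exists (pt i) => //; exists i.
  have [B HB] := poly_eval_lip W p; exists B => _ [_ [i' _ <-] <-].
  have d l : md (pt i' 0 l - pt i' 0 l) <= 0 by rewrite subrr mod0.
  by have [] := HB _ _ _ (bnd i') (bnd i') d (lexx 0).
move=> hz; apply: contrapT => zX.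
have key (p : mpoly.mpoly 2 C) (M : R) : (forall i, md (poly_eval p (pt i)) <= M) ->
    M < md (poly_eval p z) -> False.
  move=> hM; apply/negP; rewrite -leNgt; apply: (le_trans (hz p)).
  apply: ge_sup; first by exists (md (poly_eval p (pt i0))), (pt i0) => //; exists i0.
  by move=> _ [_ [i _ <-] <-].
have [[i1 ai1]|aK] := pselect (exists i1, pt i1 0 j = z 0 j); last first.
  set a := z 0 j in aK.
  have aK' i : pt i 0 j != a by apply/eqP => e; apply: aK; exists i.
  have V0 : 0 < 4 * (W + md a + 1) by have := mod_ge0 a; lra.
  have e0 : 0 < (4 * (W + md a + 1))^-1 by rewrite invr_gt0.
  have [q Hq] := out a aK' _ e0.
  have [P HP] := uni_poly j (1 - ('X - a%:P) * q).
  apply: (key P (1 / 4)) => [i|]; last first.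
    by rewrite HP !hornerE subrr mul0r subr0 mod1; lra.
  have hi := Hq _ (ex_intro2 _ _ i I erefl).
  rewrite HP hornerD hornerN hornerM hornerXsubC hornerC.
  have n0 : pt i 0 j - a != 0 by rewrite subr_eq0.
  have -> : 1 - (pt i 0 j - a) * q.[pt i 0 j] =
     - ((pt i 0 j - a) * (q.[pt i 0 j] - (pt i 0 j - a)^-1)) by field.
  rewrite modN modM.
  have h1 := modB (pt i 0 j) a; have h2 := bnd i j.
  apply: (@le_trans _ _ ((W + md a + 1) * (4 * (W + md a + 1))^-1)).
    by apply: ler_pM; rewrite ?mod_ge0 //; lra.
  by rewrite invfM mulrCA divff ?mulr1; [lra | apply/eqP => e; have := mod_ge0 a; lra].
have bn : z 0 k != pt i1 0 k.
  by apply/eqP => e; apply: zX; exists i1 => //; apply: ext.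
set v0 := pt i1 0 k in bn; set a := pt i1 0 j in ai1.
pose be := md (z 0 k - v0).
have be0 : 0 < be by rewrite mod_gt0 subr_eq0.
have e40 : 0 < be / 4 by lra.
have [c [ac cn Hc]] := peak i1 _ e40; rewrite -/a -/v0 in cn Hc.
have ac0 : 0 < md (a - c) by rewrite mod_gt0 subr_eq0 eq_sym.
pose eta := Num.min (1 / 4) (be / (8 * W + 1)).
have W8 : 0 < 8 * W + 1 by lra.
have eta0 : 0 < eta by rewrite lt_min; apply/andP; split; [lra|exact: divr_gt0].
have eta1 : eta <= 1 / 4 by rewrite ge_min lexx.
have eta2 : eta * (8 * W + 1) <= be by rewrite -ler_pdivlMr // ge_min lexx orbT.
have [q Hq] := ac (eta / md (a - c)) (divr_gt0 eta0 ac0).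
have err i : md ((a - c) * (q.[pt i 0 j] - (pt i 0 j - c)^-1)) <= eta.
  rewrite modM mulrC -ler_pdivlMr //; exact: Hq (ex_intro2 _ _ i I erefl).
have [P HP] := uni_poly j ((a - c) *: q).
pose P2 := (mpoly.mpolyX C (mpoly.mnm1 k) + mpoly.mpolyC 2 (- v0)) * P.
have P2E w : poly_eval P2 w = (w 0 k - v0) * ((a - c) * q.[w 0 j]).
  by rewrite poly_evalM poly_evalD poly_evalX poly_evalC HP hornerZ.
apply: (key P2 (be / 2)) => [i|].
  rewrite P2E.
  have -> : (pt i 0 k - v0) * ((a - c) * q.[pt i 0 j]) =
    (a - c) / (pt i 0 j - c) * (pt i 0 k - v0) +
    (a - c) * (q.[pt i 0 j] - (pt i 0 j - c)^-1) * (pt i 0 k - v0) by ring.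
  apply: (le_trans (modD _ _)); rewrite modM; have := Hc i.
  rewrite (modM ((a - c) * _)); have := err i.
  have : md (pt i 0 k - v0) <= 2 * W.
    by have := modB (pt i 0 k) v0; have := bnd i k; have := bnd i1 k; rewrite -/v0; lra.
  set x := md ((a - c) * _); set y := md (pt i 0 k - v0) => hy hx.
  have : x * y <= eta * (2 * W) by apply: ler_pM => //; exact: mod_ge0.
  lra.
rewrite P2E modM -/be -ai1.
have := err i1; rewrite -/a mulrBr divff; last by rewrite -mod_gt0.
have := modDge 1 ((a - c) * q.[a] - 1); rewrite mod1.
have -> : 1 + ((a - c) * q.[a] - 1) = (a - c) * q.[a] by ring.
nra.
Qed.
End Graph.

(** * Continuous images of the Cantor space *)

Section CantorMaps.

Lemma cylinder_nbhs (s : cantor_space) n :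
  nbhs s [set t : cantor_space | forall k, (k < n)%N -> s k = t k].
Proof.
elim: n => [|n IH].
  by apply: (filterS _ filterT) => t _ k.
have hn : nbhs s [set t : cantor_space | s n = t n].
  have := @proj_continuous nat (fun=> bool) n s [set b | s n = b].
  by apply; apply: open_nbhs_nbhs; split => //; exact: discrete_open.
apply: (filterS _ (filterI IH hn)) => t [h1 h2] k;
  rewrite ltnS leq_eqVlt => /orP[/eqP -> //|].
exact: h1.
Qed.

(** Continuity on the Cantor space means dependence on finitely many digits up to
    small errors. *)
Lemma cylinder_continuous (T : topologicalType) (f : cantor_space -> T) :
  (forall s U, nbhs (f s) U -> exists n, forall t : cantor_space,
     (forall k, (k < n)%N -> s k = t k) -> U (f t)) -> continuous f.
Proof.
move=> H s U /H[n Hn]; apply: (filterS _ (cylinder_nbhs s n)) => t /Hn //.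
Qed.

Lemma cantor_min (R : realType) (f : cantor_space -> R) : continuous f ->
  exists s, forall t, f s <= f t.
Proof.
move=> cf; have [s _ Hs] := @compact_EVT_min _ R f [set: cantor_space]
  (ex_intro _ (fun=> true) Logic.I) cantor_space_compact (continuous_subspaceT cf).
by exists s => t; apply: Hs; exact: mem_set.
Qed.

(** Continuous injections of a compact space into Hausdorff spaces are
    homeomorphisms onto their images. *)
Lemma range_homeomorphic (T U : topologicalType)
    (f : cantor_space -> T) (g : cantor_space -> U) :
  hausdorff_space T -> hausdorff_space U ->
  continuous f -> continuous g -> injective f -> injective g ->
  homeomorphic (range f) (range g).
Proof.
have half (T' U' : topologicalType) (f' : cantor_space -> T') (g' : cantor_space -> U') :
    hausdorff_space T' -> continuous f' -> continuous g' -> injective f' ->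
    exists F : T' -> U', {within range f', continuous F} /\ forall s, F (f' s) = g' s.
  move=> hT cf cg fi.
  pose F x := if pselect (exists s, f' s =
    x) is left h then g' (projT1 (cid h)) else g' (fun=> true).
  have FE s : F (f' s) = g' s.
    rewrite /F; case: pselect => [h|]; last by case; exists s.
    by congr g'; apply: fi; exact: (projT2 (cid h)).
  clearbody F; exists F; split => //; apply/subspace_continuousP => _ [s _ <-] V nV.
  have {}nV : nbhs (g' s) V by rewrite -FE.
  (* The part of the Cantor space that must be kept away from f' s. *)
  pose K := ~` (g' @^-1` V^°).
  have cK : compact K.
    apply: (subclosed_compact _ cantor_space_compact) => //.
    apply: open_closedC; apply: open_comp; last exact: open_interior.
    by move=> x _; exact: cg.
  have clK : closed (f' @` K).
    by apply: compact_closed => //; apply: continuous_compact => //;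
      exact: continuous_subspaceT.
  have nU : nbhs (f' s) (~` (f' @` K)).
    apply: open_nbhs_nbhs; split; first exact: closed_openC.
    by move=> [t Kt] /fi ts; apply: Kt; rewrite /= ts.
  rewrite /= nbhs_simpl /=; apply: (filterS _ nU) => y Uy [t _ ty].
  rewrite /= -ty /from_subspace FE; apply: (@interior_subset _ V);
    apply: contrapT => nVt; apply: Uy.
  by exists t.
move=> hT hU cf cg fi gi.
have [F [cF FE]] := half _ _ _ _ hT cf cg fi.
have [G [cG GE]] := half _ _ _ _ hU cg cf gi.
exists F, G; split => //.
- by split=> _ [s _ <-]; rewrite ?FE ?GE; exists s.
- by move=> x /set_mem[s _ <-]; rewrite FE GE.
- by move=> x /set_mem[s _ <-]; rewrite GE FE.
Qed.

End CantorMaps.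

Section MiddleThirds.
Variable R : realType.

Definition tail (s : nat -> bool) : nat -> bool := fun k => s k.+1.

Fixpoint ternary n (s : nat -> bool) : R :=
  if n is n'.+1 then (2 * (s 0%N)%:R + ternary n' (tail s)) / 3 else 0.

Lemma ternary_bounds n s : 0 <= ternary n s <= 1.
Proof.
elim: n s => [|n IH] s /=; first by rewrite lexx ler01.
by have /andP[h1 h2] := IH (tail s); case: (s 0%N) => /=; apply/andP; split; lra.
Qed.

Lemma ternary_step n s : `|ternary n.+1 s - ternary n s| <= 3^-1 ^+ n.
Proof.
elim: n s => [|n IH] s.
  by have /andP[h1 h2] := ternary_bounds 1 s; rewrite expr0 subr0 ger0_norm.
rewrite [ternary n.+2 s]/= [ternary n.+1 s]/= -/(ternary n.+1 (tail s)).
have -> : (2 * (s 0%N)%:R + ternary n.+1 (tail s)) / 3 - (2 * (s 0%N)%:R + ternary n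
  (tail s)) / 3 =
  3^-1 * (ternary n.+1 (tail s) - ternary n (tail s)) by field.
by rewrite normrM ger0_norm ?invr_ge0 // exprS ler_wpM2l ?invr_ge0.
Qed.

Lemma cantor_real_exists : exists f : (nat -> bool) ->
  R, forall s n, `|f s - ternary n s| <= 2 * 3^-1 ^+ n.
Proof.
suff : forall s, exists l : R, forall n, `|l - ternary n s| <= 2 * 3^-1 ^+ n.
  move=> h; exists (fun s => projT1 (cid (h s))) => s; exact: (projT2 (cid (h s))).
move=> s; apply: geo_lim_real; [lra|lra|move=> n].
apply: (le_trans (ternary_step n s)); have := pow3_gt0 R n; lra.
Qed.

Definition cantor_real s : R := projT1 (cid cantor_real_exists) s.

Lemma cantor_real_near s n : `|cantor_real s - ternary n s| <= 2 * 3^-1 ^+ n.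
Proof. exact: (projT2 (cid cantor_real_exists)). Qed.

Lemma real_small (x B : R) : 0 <= B -> (forall n, x <= B * 3^-1 ^+ n) -> x <= 0.
Proof.
move=> B0 h; rewrite leNgt; apply/negP => x0.
have [n hn] := geo_lt (third_ge0 R) (third_lt1 R) (divr_gt0 x0 (ltr_wpDl B0 ltr01)).
have := h n; move: hn; rewrite ltr_pdivlMr ?ltr_wpDl // => h1 h2.
by have := pow3_gt0 R n; nra.
Qed.

Lemma cantor_real_tail s :
  cantor_real s = (2 * (s 0%N)%:R + cantor_real (tail s)) / 3.
Proof.
apply/eqP; rewrite -subr_eq0 -normr_le0; apply: (@real_small _ 4) => // n.
have := cantor_real_near s n.+1; have := cantor_real_near (tail s) n.
have := pow3_gt0 R n; rewrite /= exprS !ler_norml => h0 /andP[h1 h2] /andP[h3 h4].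
by apply/andP; split; lra.
Qed.

Lemma cantor_real_bounds s : 0 <= cantor_real s <= 1.
Proof.
apply/andP; split; rewrite -subr_le0; apply: (@real_small _ 2) => // n;
have := cantor_real_near s n; have /andP[h1 h2] := ternary_bounds n s;
by rewrite ler_norml => /andP[h3 h4]; lra.
Qed.

Lemma cantor_real_common n s t : (forall k, (k < n)%N -> s k = t k) ->
  `|cantor_real s - cantor_real t| <= 3^-1 ^+ n.
Proof.
elim: n s t => [|n IH] s t st.
  have /andP[h1 h2] := cantor_real_bounds s; have /andP[h3 h4] := cantor_real_bounds t.
  by rewrite expr0 ler_norml; apply/andP; split; lra.
have h : `|cantor_real (tail s) - cantor_real (tail t)| <= 3^-1 ^+ n.
  by apply: IH => k kn; apply: st.
rewrite (cantor_real_tail s) (cantor_real_tail t) st // exprS.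
by move: h; rewrite !ler_norml => /andP[h1 h2]; apply/andP; split; lra.
Qed.

Lemma cantor_real_inj : injective cantor_real.
Proof.
have sep n s t : cantor_real s = cantor_real t -> s n = t n.
  elim: n s t => [|n IH] s t; rewrite (cantor_real_tail s) (cantor_real_tail t) => e.
    have /andP[h1 h2] := cantor_real_bounds (tail s).
    have /andP[h3 h4] := cantor_real_bounds (tail t).
    by move: e; case: (s 0%N); case: (t 0%N) => //= e; exfalso; lra.
  have e0 : s 0%N = t 0%N.
    have /andP[h1 h2] := cantor_real_bounds (tail s).
    have /andP[h3 h4] := cantor_real_bounds (tail t).
    by move: e; case: (s 0%N); case: (t 0%N) => //= e; exfalso; lra.
  by apply: (IH (tail s) (tail t)); move: e; rewrite e0; lra.
by move=> s t e; apply/funext => n; exact: sep.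
Qed.

Lemma cantor_real_cont : continuous (cantor_real : cantor_space -> R).
Proof.
apply: cylinder_continuous => s U /nbhs_ballP[e /= e0 HU].
have [n hn] := geo_lt (third_ge0 R) (third_lt1 R) e0.
by exists n => t /cantor_real_common h; apply: HU; apply: le_lt_trans h hn.
Qed.

Lemma stage_bounds n (x : R) : middle_thirds_stage n x -> 0 <= x <= 1.
Proof.
elim: n x => [|n IH] x /=; first by rewrite in_itv.
by case=> -[y /IH /andP[h1 h2] <-]; apply/andP; split; lra.
Qed.

(** A point of the middle-thirds set is recovered from its ternary digits, which
    are found by iterating the expanding map y |-> 3 y - 2 [y > 1/2]. *)
Lemma middle_thirdsE : middle_thirds (R := R) = range cantor_real.
Proof.
apply/seteqP; split => [x hx|_ [s _ <-] n _]; last first.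
  elim: n s => [|n IH] s /=; first by rewrite in_itv /= cantor_real_bounds.
  rewrite cantor_real_tail; case: (s 0%N).
    by right; exists (cantor_real (tail s)) => //; rewrite mulr1 addrC.
  by left; exists (cantor_real (tail s)) => //; rewrite mulr0 add0r.
(* The leading ternary digit of y is twice b y. *)
pose b (y : R) := 1 / 2 < y.
pose T (y : R) := 3 * y - 2 * (b y)%:R.
have TM y : middle_thirds y -> middle_thirds (T y).
  move=> My n _; have := My n.+1 Logic.I; rewrite /T /b /=.
  case=> -[z Hz <-]; have /andP[h1 h2] := stage_bounds Hz.
    have -> : (1 / 2 < z / 3) = false by apply/negbTE; rewrite -leNgt; lra.
    by have -> : 3 * (z / 3) - 2 * (nat_of_bool false)%:R = z by rewrite /= mulr0n; field.
  have -> : (1 / 2 < (z + 2) / 3) = true by lra.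
  by have -> : 3 * ((z + 2) / 3) - 2 * (nat_of_bool true)%:R = z by rewrite /= mulr1n;
    field.
have bd (y : R) : middle_thirds y -> 0 <= y <= 1.
  by move=> My; have := My 0%N Logic.I; rewrite /= in_itv.
exists (fun k => b (iter k T x)) => //.
apply/eqP; rewrite -subr_eq0 -normr_le0; apply: (@real_small _ 1) => // n.
rewrite mul1r; elim: n x hx => [|n IH] x hx.
  have /andP[h1 h2] := bd x hx.
  have /andP[h3 h4] := cantor_real_bounds (fun k => b (iter k T x)).
  by rewrite expr0 ler_norml; apply/andP; split; lra.
have := IH (T x) (TM x hx); rewrite (cantor_real_tail (fun k => b (iter k T x))).
have -> : tail (fun k => b (iter k T x)) = (fun k => b (iter k T (T x))).
  by apply/funext => k; rewrite /tail iterSr.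
set c := cantor_real _; rewrite /T /= !ler_norml exprS => /andP[h1 h2].
by apply/andP; split; lra.
Qed.

Lemma embedded_Cantor (T : topologicalType) (f : cantor_space -> T) :
  hausdorff_space T -> continuous f -> injective f -> is_Cantor_set R (range f).
Proof.
move=> hT cf fi; rewrite /is_Cantor_set middle_thirdsE.
have hR : hausdorff_space R by exact: norm_hausdorff.
exact: range_homeomorphic hT hR cf (@cantor_real_cont) fi (@cantor_real_inj).
Qed.

End MiddleThirds.

(** * Unions of two Cantor sets *)

Section UnionCantor.

(** A closed set is covered by clopen sets that miss the other one, and finitely
    many of them suffice. *)
Lemma clopen_separation (P Q : set cantor_space) : closed P -> closed Q ->
  P `&` Q = set0 -> exists U, [/\ clopen U, P `<=` U & U `&` Q = set0].
Proof.
move=> cP cQ PQ.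
have cmpP : compact P by apply: (subclosed_compact cP cantor_space_compact).
have H (s : cantor_space) : exists D : set cantor_space, clopen D /\ (P s ->
  D s /\ D `&` Q = set0).
  have [Ps|nPs] := pselect (P s); last by exists set0; split=> //; exact: clopen0.
  have nQ : nbhs s (~` Q).
    apply: open_nbhs_nbhs; split; first exact: closed_openC.
    by move=> Qs; have : (P `&` Q) s by []; rewrite PQ.
  have [D [Ds clD] DQ] := zero_dimensional_cvg cantor_space_hausdorff
    cantor_zero_dimensional
    cantor_space_compact nQ.
  exists D; split=> // _; split=> //; apply/seteqP; split=> // t [Dt Qt].
  exact: DQ Dt Qt.
pose f s := projT1 (cid (H s)).
have fP s : clopen (f s) /\ (P s -> f s s /\ f s `&` Q = set0)
  by exact: (projT2 (cid (H s))).
move: cmpP; rewrite compact_cover => /(_ cantor_space P f) [].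
- by move=> s _; case: (fP s) => -[].
- by move=> s Ps; exists s => //; case: (fP s) => _ /(_ Ps)[].
move=> F FP cov; exists (\bigcup_(i in [set` F]) f i); split => //.
- split; first by apply: bigcup_open => s _; case: (fP s) => -[].
  by apply: closed_bigcup => // s _; case: (fP s) => -[].
apply/seteqP; split => // t [[s /= sF fst] Qt].
have Ps : P s := set_mem (FP _ sF).
case: (fP s) => _ /(_ Ps)[_ e]; have : (f s `&` Q) t by [].
by rewrite e.
Qed.

(** Zero-dimensionality is the sum theorem: a separation of x and y inside the
    first compact set is extended, as a pair of disjoint closed sets, to a
    separation inside the second one.  The union has no isolated point since
    neither part has one. *)
Lemma union_cantor_like (T : topologicalType) (f g : cantor_space -> T) :
  hausdorff_space T -> continuous f -> continuous g -> injective f -> injective g ->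
  range f `|` range g = [set: T] -> cantor_like T.
Proof.
move=> hT cf cg fi gi fgT.
have clim (h : cantor_space -> T) (ch : continuous h) (A : set cantor_space) :
    closed A -> closed (h @` A).
  move=> cA; apply: compact_closed => //; apply: continuous_compact.
    exact: continuous_subspaceT.
  exact: (subclosed_compact cA cantor_space_compact).
have cpre (h : cantor_space -> T) (ch : continuous h) (A : set T) :
    closed A -> closed (h @^-1` A).
  by move=> cA; apply: closed_comp => // x _; exact: ch.
split=> //.
- apply/perfectTP => x ox.
  have bad (h : cantor_space -> T) (s : cantor_space) :
      continuous h -> injective h -> h s = x -> False.
    move=> ch hi hs; apply: (iffLR perfectTP cantor_perfect s).
    have -> : [set s] = h @^-1` [set x].
      by apply/seteqP; split=> t /=; [move=> -> | move=> tx; apply: hi; rewrite tx].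
    by apply: open_comp => // t _; exact: ch.
  have : [set: T] x by [].
  by rewrite -fgT => -[] [s _ e]; [exact: bad cf fi e | exact: bad cg gi e].
- rewrite -fgT; apply: compactU; apply: continuous_compact;
  by [exact: continuous_subspaceT | exact: cantor_space_compact].
move=> x y xy.
have cx (z : T) : closed [set z]
  by exact: accessible_closed_set1 (hausdorff_accessible hT) z.
have disj1 : (f @^-1` [set x]) `&` (f @^-1` [set y]) = set0.
  by apply/seteqP; split=> // s /= [-> e]; rewrite e eqxx in xy.
have [U1 [clU1 xU1 U1y]] :=
  clopen_separation (cpre _ cf _ (cx x)) (cpre _ cf _ (cx y)) disj1.
pose V1 := ~` U1.
have clV1 : closed V1 by apply: open_closedC; case: clU1.
have cU1 : closed U1 by case: clU1.
pose P := [set x] `|` f @` U1; pose Q := [set y] `|` f @` V1.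
have cP : closed P by apply: closedU => //; exact: clim.
have cQ : closed Q by apply: closedU => //; exact: clim.
have PQ z : P z -> Q z -> False.
  move=> [->|[s Us <-]] [e|[t Vt e]].
  - by rewrite e eqxx in xy.
  - by apply: Vt; apply: xU1.
  - by have : (U1 `&` f @^-1` [set y]) s by []; rewrite U1y.
  - by apply: Vt; have -> : t = s by exact: fi.
have disj2 : (g @^-1` P) `&` (g @^-1` Q) = set0.
  by apply/seteqP; split=> // s [h1 h2]; exact: PQ h1 h2.
have [U2 [[oU2 cU2] PU2 U2Q]] :=
  clopen_separation (cpre _ cg _ cP) (cpre _ cg _ cQ) disj2.
have cV2 : closed (~` U2) by exact: open_closedC.
pose U := P `|` g @` U2; pose V := Q `|` g @` (~` U2).
have cU : closed U by apply: closedU => //; exact: clim.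
have cV : closed V by apply: closedU => //; exact: clim.
have UV z : U z -> V z -> False.
  move=> [Pz|[s Us <-]] [Qz|[t Vt e]].
  - exact: PQ Pz Qz.
  - by apply: Vt; apply: PU2; rewrite /= e.
  - by have : (U2 `&` g @^-1` Q) s by []; rewrite U2Q.
  - by apply: Vt; have -> : t = s by exact: gi.
have UVT : ~` V = U.
  apply/seteqP; split=> z; last by move=> Uz Vz; exact: UV Uz Vz.
  move=> nV; have : [set: T] z by [].
  rewrite -fgT => -[] [s _ e].
    have [Us|Us] := pselect (U1 s); first by left; right; exists s.
    by exfalso; apply: nV; left; right; exists s.
  have [Us|Us] := pselect (U2 s); first by right; exists s.
  by exfalso; apply: nV; right; exists s.
exists U; split; last by move=> Uy; apply: (UV y Uy); left; left.
  by split=> //; rewrite -UVT; exact: closed_openC.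
by left; left.
Qed.

(** Brouwer's characterisation of the Cantor space, applied to the union with the
    subspace topology. *)
Lemma union_embedded (R : realType) (Y : pseudoMetricType R) (f g : cantor_space -> Y) :
  hausdorff_space Y -> continuous f -> continuous g -> injective f -> injective g ->
  exists h : cantor_space -> Y,
    [/\ continuous h, injective h & range h = range f `|` range g].
Proof.
move=> hY cf cg fi gi.
pose X := range f `|` range g.
have fX s : f s \in X by apply/mem_set; left; exists s.
have gX s : g s \in X by apply/mem_set; right; exists s.
pose f' s : set_type X := SigSub (fX s).
pose g' s : set_type X := SigSub (gX s).
have lift (h : cantor_space -> set_type X) : continuous (set_val \o h) -> continuous h.
  move=> ch s U [B [[A oA <-] Bs] BU]; apply: (filterS (fun _ => @BU _)).
  by apply: ch; apply: open_nbhs_nbhs.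
have hX : hausdorff_space (set_type X).
  move=> x y xy; apply: val_inj; apply: hY => A B nA nB.
  have [z [Az Bz]] := xy _ _ (@initial_continuous _ _ set_val x A nA)
    (@initial_continuous _ _ set_val y B nB).
  by exists (set_val z).
have like : cantor_like (set_type X).
  apply: (@union_cantor_like _ f' g') => //.
  - exact: lift.
  - exact: lift.
  - by move=> s t /(congr1 val)/fi.
  - by move=> s t /(congr1 val)/gi.
  apply/seteqP; split=> // -[y yX] _; have [] := set_mem yX => -[s _ e].
    by left; exists s => //; apply: val_inj.
  by right; exists s => //; apply: val_inj.
pose T := HB.pack_for (pseudoPMetricType R) (set_type X)
  (isPointed.Build (set_type X) (f' (fun=> true))).
have [h [ch _]] := @homeomorphism_cantor_like R T like.
exists (set_val \o (h : cantor_space -> set_type X)); split.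
- move=> s; apply: (@continuous_comp _ _ _ (h : cantor_space -> set_type X) set_val).
    exact: ch.
  exact: initial_continuous.
- by move=> s t /val_inj; apply: inj; exact: mem_set.
apply/seteqP; split=> [_ [s _ <-]|y Xy].
  exact: set_mem (valP (h s)).
have yX : y \in X by exact: mem_set.
have [s _ e] := @surj _ _ _ _ h (SigSub yX) Logic.I.
by exists s => //=; rewrite e.
Qed.
End UnionCantor.

(** * Polynomial convexity of the two graphs *)

Section Graphs.
Variable R : realType.
Local Notation C := R[i].
Local Notation md := (@modulus R).
Local Notation centre := (@centre R).
Local Notation D := (bool * bool)%type.

(** Identifies the Cantor space with the space of addresses. *)
Definition pairing (w : cantor_space) : nat -> D := fun k => (w k.*2, w k.*2.+1).

Lemma pairing_inj : injective pairing.
Proof.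
move=> w v e; apply/funext => n.
have /(congr1 (fun f => f n./2)) := e; rewrite /pairing => -[e1 e2].
by rewrite -[n]odd_double_half; case: (odd n); rewrite ?add1n ?add0n.
Qed.

Lemma pairing_surj s : exists w, pairing w = s.
Proof.
exists (fun n => if odd n then (s n./2).2 else (s n./2).1).
apply/funext => k; rewrite /pairing /= odd_double /= uphalf_double doubleK.
by case: (s k).
Qed.

Lemma pairing_common n (w v : cantor_space) : (forall k, (k < n.*2)%N -> w k = v k) ->
  forall k, (k < n)%N -> pairing w k = pairing v k.
Proof. by move=> h k kn; rewrite /pairing !h // ?ltn_double // ltn_Sdouble. Qed.

Lemma pairing_continuous (f : (nat -> D) -> C) (B rho : R) : 0 <= B -> 0 <= rho ->
  rho < 1 ->
  (forall s t n, (forall k, (k < n)%N -> s k = t k) -> md (f s - f t) <= B * rho ^+ n) ->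
  continuous (f \o pairing : cantor_space -> C).
Proof.
move=> B0 r0 r1 H; apply: cylinder_continuous => w U /near_disc[d d0 HU].
have [n hn] := geo_lt r0 r1 (divr_gt0 d0 (ltr_wpDl B0 ltr01)).
exists n.*2 => v /pairing_common wv; apply: HU; rewrite modBC.
apply: (le_lt_trans (H _ _ n wv)).
move: hn; rewrite ltr_pdivlMr ?ltr_wpDl //.
have : 0 <= rho ^+ n by rewrite exprn_ge0.
nra.
Qed.

Lemma Phi_cont : continuous (@Phi R \o pairing : cantor_space -> C).
Proof.
apply: (@pairing_continuous _ (80 * circle_const R) (4 / 5)); [have :=
  circle_const_ge R; lra|lra|lra|].
exact: Phi_common.
Qed.

Lemma Psi_cont : continuous (@Psi R \o pairing : cantor_space -> C).
Proof.
apply: (@pairing_continuous _ 1 3^-1); [lra|lra|lra|move=> s t n st].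
by rewrite mul1r; exact: Psi_common.
Qed.

Lemma dust_cont : continuous (@dust R \o pairing : cantor_space -> C).
Proof.
by apply: (@pairing_continuous _ 4 3^-1); [lra|lra|lra|exact: dust_common].
Qed.

(** The dust is the product of its projections, which are compact: if both
    coordinates of a were attained by the dust, then a would belong to it.
    Otherwise a vertical or a horizontal line through a keeps a positive
    distance from the dust. *)
Lemma ray_exists (a : C) : (forall s, dust R s != a) ->
  exists d u, [/\ 0 < d, md u = 1 & forall t : R, 0 <= t -> forall s,
     d <= md (a + t%:C%C * u - dust R s)].
Proof.
move=> aE.
have cRe : continuous (fun w : cantor_space => `|complex.Re a - complex.Re (dust R
  (pairing w))|).
  move=> w.
  have H : complex.Re (dust R (pairing v)) @[v --> w] --> complex.Re (dust R (pairing w)).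
    exact: (cvg_comp _ _ (@dust_cont w) (@Re_cont R _)).
  have H2 := @cvgB _ _ _ _ (nbhs_filter w) _ _ _ _ (cvg_cst (complex.Re a)) H.
  exact: (@cvg_norm _ _ _ _ (nbhs_filter w) _ _ (H2 _)).
have cIm : continuous (fun w : cantor_space => `|complex.Im a - complex.Im (dust R
  (pairing w))|).
  move=> w.
  have H : complex.Im (dust R (pairing v)) @[v --> w] --> complex.Im (dust R (pairing w)).
    exact: (cvg_comp _ _ (@dust_cont w) (@Im_cont R _)).
  have H2 := @cvgB _ _ _ _ (nbhs_filter w) _ _ _ _ (cvg_cst (complex.Im a)) H.
  exact: (@cvg_norm _ _ _ _ (nbhs_filter w) _ _ (H2 _)).
have [w1 H1] := cantor_min cRe; have [w2 H2] := cantor_min cIm.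
have [e1|n1] := eqVneq (complex.Re a) (complex.Re (dust R (pairing w1))); last first.
  exists `|complex.Re a - complex.Re (dust R (pairing w1))|, 'i%C; split.
  - by rewrite normr_gt0 subr_eq0.
  - by rewrite modE /= expr0n /= add0r expr1n sqrtr1.
  move=> t _ s; apply: le_trans (Re_le_mod _).
  have [w <-] := pairing_surj s; apply: (le_trans (H1 w)).
  by rewrite ReB ReD ReiNIm /= oppr0 addr0.
have [e2|n2] := eqVneq (complex.Im a) (complex.Im (dust R (pairing w2))); last first.
  exists `|complex.Im a - complex.Im (dust R (pairing w2))|, 1; split.
  - by rewrite normr_gt0 subr_eq0.
  - exact: mod1.
  move=> t _ s; apply: le_trans (Im_le_mod _).
  have [w <-] := pairing_surj s; apply: (le_trans (H2 w)).
  by rewrite mulr1 ImB ImD /= addr0.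
(* The address combining the real part at w1 with the imaginary part at w2. *)
exfalso; pose s k := ((pairing w1 k).1, (pairing w2 k).2).
have /eqP := aE s; apply; apply/eqP; rewrite eq_complex; apply/andP; split; apply/eqP.
  by rewrite e1; apply: Re_dust.
by rewrite e2; apply: Im_dust.
Qed.

Local Notation lo := (1 / (2 * 20 * 20) : R).
Local Notation hi := (3 / (2 * 20 * 20) : R).

Lemma Psi_runge (K : set C) (a : C) : (forall z, K z ->
  exists w, Psi R (pairing w) = z) ->
  (forall w, Psi R (pairing w) != a) -> poly_approx K (fun z => (z - a)^-1).
Proof.
move=> KP aP; have [a' a'a] := psi_surj a.
have aE s : dust R s != a'.
  have [w <-] := pairing_surj s; apply: contraNneq (aP w) => e.
  by rewrite /Psi e a'a.
have [d [u [d0 u1 H]]] := ray_exists aE.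
rewrite -a'a; apply: (@runge_ray R K (range (@dust R)) (@psi R) lo hi 55 a' u d) => //.
- by move=> z w; exact: psi_lo.
- by move=> z w; exact: psi_hi.
- by move=> z /KP[w <-]; exists (dust R (pairing w)) => //; exists (pairing w).
- by move=> z /KP[w <-]; exact: Psi_bounded.
by move=> t t0 _ [s _ <-]; exact: H.
Qed.

(** The pole c is the image of the centre of a tiny piece around dust w0.  The
    quotient (Psi w0 - c) / (Psi w - c) is bounded by porosity, and tiny unless
    w and w0 share many digits; in the latter case Phi w is close to Phi w0. *)
Lemma Psi_peak (w0 : cantor_space) (e : R) : 0 < e -> exists c : C,
  (forall w, Psi R (pairing w) != c) /\
  (forall w, md ((Psi R (pairing w0) - c) / (Psi R (pairing w) - c)) *
      md (Phi R (pairing w) - Phi R (pairing w0)) <= e).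
Proof.
move=> e0; set s := pairing w0.
have K0 := circle_const_ge R.
pose W := 40 * circle_const R + 1.
have W0 : 0 < W by rewrite /W; lra.
have q0 : 0 < e / (30 * 80 * circle_const R) by apply: divr_gt0 => //; lra.
have [N hN] : exists N, (4 / 5 : R) ^+ N < e / (30 * 80 * circle_const R)
  by apply: geo_lt => //; lra.
have p0 := pow3_gt0 R N.
have r0 : 0 < Num.min (1 / 20) (e / (120 * W)) * 3^-1 ^+ N.
  by apply: mulr_gt0 => //; rewrite lt_min; apply/andP; split;
    [lra|apply: divr_gt0 => //; lra].
have [n hn] := geo_lt (third_ge0 R) (third_lt1 R) r0.
have pn := pow3_gt0 R n.
have n20 : 3^-1 ^+ n <= (1 : R) / 20 * 3^-1 ^+ N.
  by apply: le_trans (ltW hn) _; rewrite ler_pM2r // ge_min lexx.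
have nW : 3^-1 ^+ n * (120 * W) <= e * 3^-1 ^+ N.
  rewrite -ler_pdivlMr ?mulr_gt0 // mulrAC; apply: (le_trans (ltW hn)).
  by rewrite ler_pM2r // ge_min lexx orbT.
pose y := centre (mkseq s n); exists (psi y).
have low w : lo * (1 / 5 * 3^-1 ^+ n) <= md (Psi R (pairing w) - psi y).
  apply: le_trans (psi_lo _ _); have := dust_away R (pairing w) (mkseq s n);
    rewrite size_mkseq -/y.
  lra.
have neq w : Psi R (pairing w) != psi y.
  by rewrite -subr_eq0 -mod_gt0; have := low w; lra.
split=> // w.
have num : md (Psi R s - psi y) <= hi * (2 * 3^-1 ^+ n).
  by have := psi_hi (dust R s) y; have := dust_near R s n; rewrite -/y -/(Psi R s); lra.
have num0 := mod_ge0 (Psi R s - psi y).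
have den0 : 0 < md (Psi R (pairing w) - psi y) by rewrite mod_gt0 subr_eq0.
have v0 := mod_ge0 (Phi R (pairing w) - Phi R s).
rewrite modM modV mulrAC ler_pdivrMr //.
have [h|/existsNP[k /not_implyP[kN sk]]] := pselect (forall k, (k < N)%N ->
  pairing w k = s k).
  have := Phi_common R h; set v := md (Phi R _ - _) in v0 *; move=> hv.
  have hv' : v * 30 <= e.
    move: hN; rewrite ltr_pdivlMr; last by lra.
    lra.
  have := low w; nra.
have dist : 1 / 5 * 3^-1 ^+ N <= md (dust R (pairing w) - dust R s).
  by apply: (dust_sep R kN); apply/eqP.
have far : lo * (1 / 10 * 3^-1 ^+ N) <= md (Psi R (pairing w) - psi y).
  apply: le_trans (psi_lo _ _).
  have := modDist (dust R (pairing w)) y (dust R s); have := dust_near R s n;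
    rewrite -/y (modBC _ y); lra.
have hv : md (Phi R (pairing w) - Phi R s) <= 2 * W.
  by have := modB (Phi R (pairing w)) (Phi R s); have := Phi_bounded R (pairing w);
    have := Phi_bounded R s; rewrite /W; lra.
have a1 : md (Psi R s - psi y) * md (Phi R (pairing w) - Phi R s) <= hi * (2 * 3^-1 ^+
  n) * (2 * W).
  by apply: ler_pM.
apply: (le_trans a1); have a2 : e * (lo * (1 / 10 * 3^-1 ^+ N)) <= e * md (Psi R
  (pairing w) - psi y).
  by rewrite ler_pM2l.
apply: le_trans a2; lra.
Qed.

Lemma graph_convex (pt : cantor_space -> 'rV[C]_2) (j k : 'I_2) :
  (forall z w : 'rV[C]_2, z 0 j = w 0 j -> z 0 k = w 0 k -> z = w) ->
  (forall l, l = j \/ l = k) ->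
  (forall w, pt w 0 j = Psi R (pairing w)) -> (forall w, pt w 0 k = Phi R (pairing w)) ->
  polynomially_convex (range pt).
Proof.
move=> ext jk ptj ptk; pose W := Num.max 55 (40 * circle_const R + 1).
have KP (z : C) : range (fun w => pt w 0 j) z -> exists w, Psi R (pairing w) = z.
  by move=> [w _ <-]; exists w.
apply: (@polynomially_convex_graph R _ pt j k (fun=> true) W) => //.
- move=> w l; case: (jk l) => ->; rewrite ?ptj ?ptk le_max.
    by rewrite Psi_bounded.
  by rewrite Phi_bounded orbT.
- by move=> a aP; apply: Psi_runge => // w; rewrite -ptj.
move=> w0 e e0; have [c [cP Hc]] := Psi_peak w0 e0; exists c; split.
- exact: Psi_runge.
- by rewrite ptj eq_sym.
by move=> w; rewrite !ptj !ptk.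
Qed.

End Graphs.

(** * The rational hull of the union *)

Section Vanishing.
Variable R : realType.
Local Notation C := R[i].
Local Notation md := (@modulus R).
Variable L : seq C.
Let Den z : C := \prod_(b <- L) (z - b).
Let DenP : {poly C} := \prod_(b <- L) ('X - b%:P).

Let DenE z : DenP.[z] = Den z.
Proof. by rewrite horner_prod; apply: eq_bigr => b _; rewrite hornerXsubC. Qed.

(** Rational functions with poles in [L] that vanish at infinity: the numerator
    has smaller degree than the denominator, a power of the product of the
    z - b with b in L.  Nothing is required at the poles. *)
Definition vanishing (f : C -> C) := exists m (P : {poly C}),
  (size P <= m * size L)%N /\ forall z, Den z != 0 -> f z = P.[z] / Den z ^+ m.

Lemma vanishing_ext f g : (forall z, f z = g z) -> vanishing f -> vanishing g.
Proof. by move=> fg [m [P [sP H]]]; exists m, P; split=> // z /H <-. Qed.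

Lemma vanishing0 : vanishing (fun=> 0).
Proof.
by exists 0%N, 0; rewrite size_poly0; split=> // z _; rewrite horner0 mul0r.
Qed.

Let size_DenX m : size (DenP ^+ m) = (m * size L).+1.
Proof.
have mon : DenP \is monic by apply: monic_prod_XsubC.
rewrite (polySpred (monic_neq0 (monic_exp m mon))) size_exp.
by rewrite size_prod_XsubC /= mulnC.
Qed.

Lemma vanishingD f g : vanishing f -> vanishing g -> vanishing (fun z => f z + g z).
Proof.
move=> [m1 [P1 [s1 H1]]] [m2 [P2 [s2 H2]]].
exists (m1 + m2)%N, (P1 * DenP ^+ m2 + P2 * DenP ^+ m1); split.
  apply: (leq_trans (size_polyD _ _)); rewrite geq_max; apply/andP; split.
    apply: (leq_trans (size_polyMleq _ _)); rewrite size_DenX addnS /= mulnDl.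
    by rewrite leq_add2r.
  apply: (leq_trans (size_polyMleq _ _)); rewrite size_DenX addnS /= mulnDl addnC.
  by rewrite leq_add2l.
move=> z Dz; rewrite H1 // H2 // hornerD !hornerM !horner_exp !DenE exprD.
by field; rewrite !expf_neq0.
Qed.

Lemma vanishingM f g : vanishing f -> vanishing g -> vanishing (fun z => f z * g z).
Proof.
move=> [m1 [P1 [s1 H1]]] [m2 [P2 [s2 H2]]].
exists (m1 + m2)%N, (P1 * P2); split.
  apply: (leq_trans (size_polyMleq _ _)); apply: (leq_trans (leq_pred _)).
  by rewrite mulnDl leq_add.
move=> z Dz; rewrite H1 // H2 // hornerM exprD.
by field; rewrite !expf_neq0.
Qed.

Lemma vanishingZ a f : vanishing f -> vanishing (fun z => a * f z).
Proof.
move=> [m [P [sP H]]]; exists m, (a *: P); split.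
  exact: leq_trans (size_scale_leq _ _) sP.
by move=> z Dz; rewrite H // hornerZ mulrA.
Qed.

Lemma vanishing_pole b : b \in L -> vanishing (fun z => (z - b)^-1).
Proof.
move=> bL; exists 1%N, (\prod_(c <- rem b L) ('X - c%:P)); split.
  by rewrite size_prod_XsubC size_rem // mul1n prednK // -has_predT; apply/hasP; exists b.
move=> z; rewrite expr1 /Den (big_rem b bL) /= horner_prod.
have -> : \prod_(c <- rem b L) ('X - c%:P).[z] = \prod_(c <- rem b L) (z - c).
  by apply: eq_bigr => c _; rewrite hornerXsubC.
by rewrite mulf_eq0 negb_or => /andP[h1 h2]; field; rewrite h1 h2.
Qed.

Lemma vanishing_mean n (f : C -> seq (bool * bool) -> C) :
  (forall w, size w = n -> vanishing (fun z => f z w)) ->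
  vanishing (fun z => mean n (f z)).
Proof.
elim: n f => [|n IH] f H; first exact: H.
apply: vanishingZ.
suff sums (r : seq (bool * bool)) :
  vanishing (fun z => \sum_(d <- r) mean n (fun w => f z (d :: w))) by exact: sums.
elim: r => [|d r IHr]; first by apply: vanishing_ext vanishing0 => z; rewrite big_nil.
have h := IH (fun z w => f z (d :: w)) (fun w sw => H (d :: w) (congr1 S sw)).
by apply: vanishing_ext (vanishingD h IHr) => z; rewrite big_cons.
Qed.

(** With a = f - f(0) and b = g - g(0), the product f g differs from f(0) g(0) by
    a b + f(0) b + g(0) a, which again vanishes at infinity. *)
Lemma vanishing_poly (v : C -> 'rV[C]_2) (p : mpoly.mpoly 2 C) :
  (forall j, vanishing (fun z => v z 0 j)) ->
  vanishing (fun z => poly_eval p (v z) - poly_eval p 0).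
Proof.
move=> hv; pose Q (g : 'rV[C]_2 -> C) := vanishing (fun z => g (v z) - g 0).
apply: (@poly_eval_ind R 2 Q) => [c|j|f g hf hg|f g hf hg].
- by apply: vanishing_ext vanishing0 => z; rewrite subrr.
- by apply: vanishing_ext (hv j) => z; rewrite mxE subr0.
- by apply: vanishing_ext (vanishingD hf hg) => z; ring.
apply: vanishing_ext (vanishingD (vanishingM hf hg)
  (vanishingD (vanishingZ (f 0) hg) (vanishingZ (g 0) hf))) => z; ring.
Qed.
End Vanishing.

Section RationalHull.
Variable R : realType.
Local Notation C := R[i].
Local Notation md := (@modulus R).
Local Notation centre := (@centre R).
Local Notation D := (bool * bool)%type.

Definition words n : seq (seq D) := [seq tval t | t <- enum {: n.-tuple D}].

Lemma mem_words n w : (w \in words n) = (size w == n).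
Proof.
apply/mapP/idP => [[t _ ->]|sw]; first by rewrite size_tuple.
by exists (Tuple sw) => //; rewrite mem_enum.
Qed.

Lemma words_uniq n : uniq (words n).
Proof. by rewrite map_inj_uniq ?enum_uniq //; exact: val_inj. Qed.

(** The poles at generation n of the two coordinates of z |-> (F(z), F(20 - z)). *)
Definition poles n : seq C :=
  map centre (words n) ++ map (fun w => 20 - centre w) (words n).

Lemma polesP n c : c \in poles n ->
  exists2 w, size w = n & c = centre w \/ c = 20 - centre w.
Proof.
rewrite mem_cat => /orP[] /mapP[w]; rewrite mem_words => /eqP sw ->; exists w => //.
  by left.
by right.
Qed.

Lemma centre_inj w w' : size w = size w' -> centre w = centre w' -> w = w'.
Proof.
move=> sw e; apply/eqP; rewrite -[_ == _]negbK; apply/negP => ne.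
by have := centre_sep R sw ne; rewrite e subrr mod0; have := pow3_gt0 R (size w); lra.
Qed.

Lemma poles_far w w' : 18 <= md (centre w - (20 - centre w')).
Proof.
have := modBge 20 (centre w + centre w'); rewrite mod_nat.
have -> : 20 - (centre w + centre w') = - (centre w - (20 - centre w')) by ring.
by rewrite modN; have := modD (centre w) (centre w'); have := centre_le R w; have :=
  centre_le R w'; lra.
Qed.

Lemma poles_uniq n : uniq (poles n).
Proof.
rewrite cat_uniq; apply/and3P; split.
- rewrite map_inj_in_uniq ?words_uniq // => w w'; rewrite !mem_words => /eqP sw /eqP sw'.
  by apply: centre_inj; rewrite sw sw'.
- apply/hasPn => c /mapP[w' _ ->]; apply/negP => /mapP[w _ e].
  by have := poles_far w w'; rewrite e subrr mod0; lra.
rewrite map_inj_in_uniq ?words_uniq // => w w'; rewrite !mem_words => /eqP sw /eqP sw' e.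
by apply: centre_inj; [rewrite sw sw' | apply/oppr_inj/(addrI 20)].
Qed.

Lemma poles_sep n c c' : c \in poles n -> c' \in poles n -> c != c' ->
  2 * 3^-1 ^+ n <= md (c - c').
Proof.
move=> /polesP[w sw hw] /polesP[w' sw' hw'] ne.
have same (ww : w != w') : 2 * 3^-1 ^+ n <= md (centre w - centre w').
  by have := @centre_sep R w w'; rewrite sw sw'; apply.
have p1 := pow3_le1 R n.
case: hw hw' => -> [] -> in ne *.
- by apply: same; apply: contraNneq ne => ->.
- by have := poles_far w w'; lra.
- by rewrite modBC; have := poles_far w' w; lra.
have -> : 20 - centre w - (20 - centre w') = - (centre w - centre w') by ring.
by rewrite modN; apply: same; apply: contraNneq ne => ->.
Qed.

Lemma poles_size n : (0 < size (poles n))%N.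
Proof.
rewrite -has_predT; apply/hasP; exists (centre (nseq n (true, true))) => //.
by rewrite mem_cat map_f // mem_words size_nseq eqxx.
Qed.

Definition pt2 (a b : C) : 'rV[C]_2 := \row_j (if j == 0 then a else b).

Lemma pt20 a b : pt2 a b 0 0 = a. Proof. by rewrite mxE. Qed.
Lemma pt21 a b : pt2 a b 0 1 = b. Proof. by rewrite mxE. Qed.

Lemma I2 (j : 'I_2) : j = 0 \/ j = 1.
Proof. by case: j => [[|[|//]]] h; [left|right]; apply: val_inj. Qed.

Lemma vanishing_potential n : vanishing (poles n) (potential n).
Proof.
apply: vanishing_mean => w sw; apply: vanishing_pole.
by rewrite mem_cat map_f // mem_words sw eqxx.
Qed.

Lemma vanishing_potential_reflected n : vanishing (poles n) (fun z => potential n (20 -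
  z)).
Proof.
apply: vanishing_mean => w sw; have h : 20 - centre w \in poles n.
  by rewrite mem_cat [X in _ || X]map_f ?orbT // mem_words sw eqxx.
apply: vanishing_ext (vanishingZ (-1) (vanishing_pole h)) => z.
by rewrite mulN1r -invrN; congr (_^-1); ring.
Qed.

Lemma far_potential_lip (z z' : C) : 1 <= md z -> 1 <= md z' ->
  md (far_potential z - far_potential z') <= 25 * md (z - z').
Proof.
move=> hz hz'; rewrite -[X in md X]subr0; apply: far_potential_limit => // n.
by rewrite subr0; exact: potential_lip.
Qed.

Local Notation eps n := (40 * circle_const R * (4 / 5) ^+ n).

(** On the circle around a piece both coordinates are close to the point of X2
    given by any address in that piece. *)
Lemma circle_near n w s y : mkseq s n = w -> md (y - centre w) = 3^-1 ^+ n ->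
  md (potential n y - Phi R s) <= eps n /\ md (potential n (20 - y) - Psi R s) <= eps n.
Proof.
move=> sw hy; have hy' := hy; rewrite -sw in hy'.
split; first by rewrite modBC; exact: Phi_near.
have sz : size w = n by rewrite -sw size_mkseq.
have y1 : md y <= 8 / 5.
  by have := centre_nested R w; rewrite sz; have := modD (y - centre w) (centre w);
    rewrite subrK hy; lra.
have e1 : md (dust R s) <= 8 / 5 by have := dust_le R s; lra.
have := far_potential_near n (far20 y1); have := far_potential_lip (far20 y1) (far20 e1).
have -> : 20 - y - (20 - dust R s) = dust R s - y by ring.
have := modDist (dust R s) (centre w) y; rewrite [md (centre w - y)]modBC hy.
have := dust_near R s n; rewrite sw /Psi psi_dust.
have := modDist (potential n (20 - y)) (far_potential (20 - y)) (far_potential (20 -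
  dust R s)).
rewrite (modBC (potential n _) (far_potential (20 - y))).
have q : 3^-1 ^+ n <= (4 / 5 : R) ^+ n by apply: lerXn2r; rewrite ?nnegrE; lra.
have : 50 * 60 * (4 / 5) ^+ n <= circle_const R * (4 / 5) ^+ n.
  by rewrite ler_wpM2r ?circle_const_ge // exprn_ge0 //; lra.
have := pow3_gt0 R n; lra.
Qed.

(** X2 is the range of [graph2], X1 that of [graph1], and X is [graphs]. *)
Definition graph2 (w : cantor_space) := pt2 (Phi R (pairing w)) (Psi R (pairing w)).
Definition graph1 (w : cantor_space) := pt2 (Psi R (pairing w)) (Phi R (pairing w)).
Definition graphs := range graph1 `|` range graph2.

(** For a pole of the second kind the reflection z |-> 20 - z exchanges the
    coordinates and leads to a point of X1. *)
Lemma pole_near n c : c \in poles n -> exists x, graphs x /\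
  forall y, md (y - c) = 3^-1 ^+ n ->
    forall j, md (pt2 (potential n y) (potential n (20 - y)) 0 j - x 0 j) <= eps n.
Proof.
move=> /polesP[w sw hc].
pose s k := nth (true, true) w k.
have prew : mkseq s n = w by rewrite -sw; exact: mkseq_nth.
have [u us] := pairing_surj s.
case: hc => ->.
  exists (graph2 u); split; first by right; exists u.
  move=> y hy j; have [h1 h2] := circle_near prew hy.
  by case: (I2 j) => ->; rewrite /graph2 ?pt20 ?pt21 us.
exists (graph1 u); split; first by left; exists u.
move=> y hy j; have hy' : md (20 - y - centre w) = 3^-1 ^+ n.
  by rewrite -hy -modN; congr md; ring.
have [h1 h2] := circle_near prew hy'.
have e : 20 - (20 - y) = y by ring.
rewrite e in h2.
by case: (I2 j) => ->; rewrite /graph1 ?pt20 ?pt21 us.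
Qed.

(** A common bound for the coordinates of X1 and X2 and for the potentials on the
    circles. *)
Definition polyradius : R := 80 * circle_const R + 100.

Lemma graphs_bound x j : graphs x -> md (x 0 j) <= 40 * circle_const R + 55.
Proof.
have K := circle_const_ge R.
by case=> -[w _ <-]; case: (I2 j) => ->; rewrite ?pt20 ?pt21;
  have := Psi_bounded R (pairing w); have := Phi_bounded R (pairing w); lra.
Qed.

Lemma poly_min (p : mpoly.mpoly 2 C) (f1 f2 : (nat -> D) -> C) :
  (forall s, md (f1 s) <= polyradius) -> (forall s, md (f2 s) <= polyradius) ->
  (forall s t n, (forall k, (k < n)%N -> s k = t k) ->
    md (f1 s - f1 t) <= 80 * circle_const R * (4 / 5) ^+ n) ->
  (forall s t n, (forall k, (k < n)%N -> s k = t k) ->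
    md (f2 s - f2 t) <= 80 * circle_const R * (4 / 5) ^+ n) ->
  (forall w : cantor_space, poly_eval p (pt2 (f1 (pairing w)) (f2 (pairing w))) !=
    poly_eval p 0) ->
  exists2 d : R, 0 < d & forall w : cantor_space,
    d <= md (poly_eval p (pt2 (f1 (pairing w)) (f2 (pairing w))) - poly_eval p 0).
Proof.
move=> b1 b2 c1 c2 ne.
have K := circle_const_ge R.
have [B HB] := poly_eval_lip polyradius p.
pose f s := poly_eval p (pt2 (f1 s) (f2 s)) - poly_eval p 0.
have bd s j : md (pt2 (f1 s) (f2 s) 0 j) <= polyradius by case: (I2 j) => ->;
  rewrite ?pt20 ?pt21.
have B0 : 0 <= B.
  have d0 j : md (pt2 (f1 (fun=> (true, true))) (f2 (fun=> (true, true))) 0 j -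
    pt2 (f1 (fun=> (true, true))) (f2 (fun=> (true, true))) 0 j) <= 0
      by rewrite subrr mod0.
  have [h _] := HB _ _ _ (bd (fun=> (true, true))) (bd (fun=> (true, true))) d0 (lexx 0).
  exact: le_trans (mod_ge0 _) h.
have cf : continuous (f \o pairing : cantor_space -> C).
  apply: (@pairing_continuous R f (B * (80 * circle_const R)) (4 / 5)); [|lra|lra|].
    by apply: mulr_ge0 => //; lra.
  move=> s t n st.
  have -> : B * (80 * circle_const R) * (4 / 5) ^+ n =
    B * (80 * circle_const R * (4 / 5) ^+ n) by ring.
  have e0 : 0 <= 80 * circle_const R * (4 / 5) ^+ n.
    by apply: mulr_ge0; [lra|apply: exprn_ge0; lra].
  have d j : md (pt2 (f1 s) (f2 s) 0 j - pt2 (f1 t) (f2 t) 0 j) <= 80 * circle_const R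
    * (4 / 5) ^+ n.
    by case: (I2 j) => ->; rewrite ?pt20 ?pt21; [exact: c1|exact: c2].
  have [_ h] := HB _ _ _ (bd s) (bd t) d e0.
  have -> : f s - f t = poly_eval p (pt2 (f1 s) (f2 s)) - poly_eval p (pt2 (f1 t) (f2 t)).
    by rewrite /f; ring.
  exact: h.
have cm : continuous (fun w : cantor_space => md (f (pairing w))).
  by move=> w; exact: (cvg_comp _ _ (cf w) (@mod_cont R _)).
have [w Hw] := cantor_min cm.
by exists (md (f (pairing w))) => //; rewrite mod_gt0 subr_eq0.
Qed.

(** If p avoids p(0) on X, then |p - p(0)| >= d > 0 there by compactness.  For large
    n the values on each circle are within d of a value ga of p - p(0) on X, so
    that after multiplication by the conjugate of ga they have positive real
    part, against [nonpositive_on_circle]. *)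
Lemma zero_in_rational_hull : rational_hull graphs 0.
Proof.
move=> p; apply: contrapT => np.
have K := circle_const_ge R.
have ne x : graphs x -> poly_eval p x != poly_eval p 0.
  by move=> Xx; apply/eqP => e; apply: np; exists x.
have Psib s : md (Psi R s) <= polyradius by have := Psi_bounded R s;
  rewrite /polyradius; lra.
have Phib s : md (Phi R s) <= polyradius by have := Phi_bounded R s;
  rewrite /polyradius; lra.
have Psic s t n : (forall k, (k < n)%N -> s k = t k) ->
  md (Psi R s - Psi R t) <= 80 * circle_const R * (4 / 5) ^+ n.
  move=> /(@Psi_common R) h; apply: (le_trans h).
  have q : 3^-1 ^+ n <= (4 / 5 : R) ^+ n by apply: lerXn2r; rewrite ?nnegrE; lra.
  by apply: (le_trans q); rewrite ler_peMl ?exprn_ge0 //; lra.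
have [d2 d20 H2] := poly_min Phib Psib (@Phi_common R) Psic (fun w => ne _ (or_intror
  (ex_intro2 _ _ w Logic.I erefl))).
have [d1 d10 H1] := poly_min Psib Phib Psic (@Phi_common R) (fun w => ne _ (or_introl
  (ex_intro2 _ _ w Logic.I erefl))).
pose d := Num.min d1 d2.
have d0 : 0 < d by rewrite lt_min d10 d20.
have Hd x : graphs x -> d <= md (poly_eval p x - poly_eval p 0).
  by case=> -[w _ <-]; rewrite ge_min; apply/orP; [left; exact: H1|right; exact: H2].
have [B HB] := poly_eval_lip polyradius p.
have B00 : 0 <= `|B| * (40 * circle_const R) by apply: mulr_ge0 => //; lra.
have B1 : 0 < `|B| * (40 * circle_const R) + 1 by lra.
have [n hn] : exists n, (4 / 5 : R) ^+ n < d / (`|B| * (40 * circle_const R) + 1).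
  by apply: geo_lt; [lra|lra|exact: divr_gt0].
have q0 : 0 <= (4 / 5 : R) ^+ n by apply: exprn_ge0; lra.
have q1 : (4 / 5 : R) ^+ n <= 1 by rewrite exprn_ile1 //; lra.
have e0 : 0 <= eps n by apply: mulr_ge0 => //; lra.
have e1 : eps n <= 40 * circle_const R by rewrite -[leRHS]mulr1;
  apply: ler_wpM2l => //; lra.
have Be : B * eps n < d.
  move: hn; rewrite ltr_pdivlMr // => hn; apply: le_lt_trans hn.
  have := ler_norm B; have : 0 <= `|B| by [].
  move=> g0 g1; have : B * eps n <= `|B| * eps n by apply: ler_wpM2r.
  lra.
pose v z := pt2 (potential n z) (potential n (20 - z)).
have [m [P [sP HP]]] : vanishing (poles n) (fun z => poly_eval p (v z) - poly_eval p 0).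
  apply: vanishing_poly => // j; case: (I2 j) => ->.
    by apply: vanishing_ext (vanishing_potential n) => z; rewrite pt20.
  by apply: vanishing_ext (vanishing_potential_reflected n) => z; rewrite pt21.
pose near_pt c x := graphs x /\ forall y, md (y - c) = 3^-1 ^+ n ->
    forall j, md (v y 0 j - x 0 j) <= eps n.
pose g c : C := if pselect (exists x, near_pt c x) is left h
  then ((poly_eval p (projT1 (cid h)) - poly_eval p 0)^*)%C else 0.
have [c cL [y yc]] := @nonpositive_on_circle R (poles n) m (3^-1 ^+ n) P g
  (pow3_gt0 R n) (poles_uniq n) (poles_size n) (@poles_sep n) sP.
have pn := pow3_gt0 R n.
have Den0 : \prod_(b <- poles n) (y - b) != 0.
  rewrite prodf_seq_neq0; apply/allP => b bL; rewrite subr_eq0; apply/eqP => yb.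
  have [bc|bc] := eqVneq b c; first by move: yc; rewrite yb bc subrr mod0; lra.
  by have := poles_sep bL cL bc; rewrite -yb yc; lra.
rewrite -HP // /g; case: pselect => [h|]; last first.
  by move=> nex _; apply: nex; have [x [h1 h2]] := pole_near cL; exists x.
case: (cid h) => x [Xx Hx] /=.
apply/negP; rewrite -ltNge.
set ga := poly_eval p x - _; set hy := poly_eval p (v y) - _.
have gd : d <= md ga by exact: Hd.
have vW j : md (v y 0 j) <= polyradius.
  have := Hx _ yc j; have := graphs_bound j Xx; have := modD (v y 0 j - x 0 j) (x 0 j).
  by rewrite subrK /polyradius; lra.
have xW j : md (x 0 j) <= polyradius by have := graphs_bound j Xx; rewrite /polyradius;
  lra.
have [_ hB] := HB _ _ _ vW xW (Hx _ yc) e0.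
have dif : md (hy - ga) < md ga.
  have -> : hy - ga = poly_eval p (v y) - poly_eval p x by rewrite /hy /ga; ring.
  by apply: le_lt_trans hB _; apply: lt_le_trans Be gd.
have -> : hy * (ga^*)%C = (md ga ^+ 2)%:C%C + (hy - ga) * (ga^*)%C.
  by rewrite -mulJ; ring.
rewrite ReD [complex.Re _%:C%C]/=.
have := Re_le_mod ((hy - ga) * (ga^*)%C); rewrite modM mod_conj ler_norml => /andP[h1 _].
have := mod_ge0 (hy - ga); nra.
Qed.

End RationalHull.

(** * The union is a Cantor set *)

Section CantorSets.
Variable R : realType.
Local Notation C := R[i].
Local Notation md := (@modulus R).

Lemma pt2_cont (T : topologicalType) (a b : T -> C) : continuous a -> continuous b ->
  continuous (fun t => pt2 (a t) (b t)).
Proof.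
move=> ca cb t; pose f s := pt2 (a s) (b s).
suff H : forall e : C, 0 < e -> \forall s \near t, @ball C 'rV[C]_2 (f t) e (f s).
  by move=> U /nbhs_ballP[e /= e0 HU]; apply: filterS (H e e0) => s; exact: HU.
move=> e e0.
have ha := @cvgr_dist_lt C C T (nbhs t) (nbhs_filter t) a (a t) (ca t) e e0.
have hb := @cvgr_dist_lt C C T (nbhs t) (nbhs_filter t) b (b t) (cb t) e e0.
apply: (filterS _ (filterI ha hb)) => s [h1 h2]; split=> // i j.
by rewrite !mxE -ball_normE /=; case: ifP.
Qed.

Lemma pt2_inj (a b a' b' : C) : pt2 a b = pt2 a' b' -> a = a' /\ b = b'.
Proof.
by move=> e; rewrite -(pt20 a b) -[b in _ /\ b = _](pt21 a b) e pt20 pt21.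
Qed.

Lemma pt2_ext (z w : 'rV[C]_2) : z 0 0 = w 0 0 -> z 0 1 = w 0 1 -> z = w.
Proof.
by move=> h0 h1; apply/rowP => j; case: (I2 j) => ->.
Qed.

Lemma graph2_inj : injective (@graph2 R).
Proof. by move=> w v /pt2_inj[_] /(@Psi_inj R)/pairing_inj. Qed.

Lemma graph1_inj : injective (@graph1 R).
Proof. by move=> w v /pt2_inj[] /(@Psi_inj R)/pairing_inj. Qed.

Lemma row_hausdorff : hausdorff_space 'rV[C]_2.
Proof. exact: norm_hausdorff. Qed.

Lemma graph2_cont : continuous (@graph2 R).
Proof. exact: (pt2_cont (@Phi_cont R) (@Psi_cont R)). Qed.

Lemma graph1_cont : continuous (@graph1 R).
Proof. exact: (pt2_cont (@Psi_cont R) (@Phi_cont R)). Qed.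

Lemma graph2_convex : polynomially_convex (range (@graph2 R)).
Proof.
apply: (@graph_convex R _ 1 0).
- by move=> z w h1 h0; apply: pt2_ext.
- by move=> l; case: (I2 l); [right|left].
- by move=> w; rewrite pt21.
by move=> w; rewrite pt20.
Qed.

Lemma graph1_convex : polynomially_convex (range (@graph1 R)).
Proof.
apply: (@graph_convex R _ 0 1).
- by move=> z w h1 h0; apply: pt2_ext.
- exact: I2.
- by move=> w; rewrite pt20.
by move=> w; rewrite pt21.
Qed.

Definition of_real4 (y : (R * R) * (R * R)) : 'rV[C]_2 :=
  pt2 (y.1.1 +i* y.1.2)%C (y.2.1 +i* y.2.2)%C.
(** The characterisation of the Cantor space applies to spaces metrised over [R],
    so the union is moved to real coordinates. *)
Definition to_real4 (z : 'rV[C]_2) : (R * R) * (R * R) :=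
  ((complex.Re (z 0 0), complex.Im (z 0 0)), (complex.Re (z 0 1), complex.Im (z 0 1))).

Lemma to_real4K : cancel to_real4 of_real4.
Proof. by move=> z; apply: pt2_ext; rewrite ?pt20 ?pt21 /= mkReIm. Qed.

Lemma of_real4K : cancel of_real4 to_real4.
Proof. by move=> [[a b] [c d]]; rewrite /to_real4 pt20 pt21. Qed.

Lemma of_real4_cont : continuous of_real4.
Proof.
apply: pt2_cont => y.
  exact: (@continuous_comp _ _ _ fst (fun x : R * R => (x.1 +i* x.2)%C) y cvg_fst
    (@complex_pair_cont R _)).
exact: (@continuous_comp _ _ _ snd (fun x : R * R => (x.1 +i* x.2)%C) y cvg_snd
  (@complex_pair_cont R _)).
Qed.

Lemma to_real4_pt2_cont (a b : cantor_space -> C) : continuous a -> continuous b ->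
  continuous (fun w => to_real4 (pt2 (a w) (b w))).
Proof.
move=> ca cb w.
have -> : (fun w => to_real4 (pt2 (a w) (b w))) = (fun w =>
    ((complex.Re (a w), complex.Im (a w)), (complex.Re (b w), complex.Im (b w)))).
  by apply/funext => v; rewrite /to_real4 pt20 pt21.
have a1 : complex.Re (a v) @[v --> w] --> complex.Re (a w).
  exact: (cvg_comp _ _ (ca w) (@Re_cont R _)).
have a2 : complex.Im (a v) @[v --> w] --> complex.Im (a w).
  exact: (cvg_comp _ _ (ca w) (@Im_cont R _)).
have b1 : complex.Re (b v) @[v --> w] --> complex.Re (b w).
  exact: (cvg_comp _ _ (cb w) (@Re_cont R _)).
have b2 : complex.Im (b v) @[v --> w] --> complex.Im (b w).
  exact: (cvg_comp _ _ (cb w) (@Im_cont R _)).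
exact: (cvg_pair (cvg_pair a1 a2) (cvg_pair b1 b2)).
Qed.

Lemma graphs_Cantor : is_Cantor_set R (@graphs R).
Proof.
have hY : hausdorff_space ((R * R) * (R * R))%type by exact: norm_hausdorff.
have ri := can_inj to_real4K.
have [h [ch hi hE]] := @union_embedded R ((R * R) * (R * R))%type (to_real4 \o @graph1
  R) (to_real4 \o @graph2 R) hY
  (to_real4_pt2_cont (@Psi_cont R) (@Phi_cont R))
  (to_real4_pt2_cont (@Phi_cont R) (@Psi_cont R))
  (inj_comp ri graph1_inj) (inj_comp ri graph2_inj).
have -> : @graphs R = range (of_real4 \o h).
  apply/seteqP; split=> x.
    case=> -[w _ <-].
      have : range h (to_real4 (graph1 R w)) by rewrite hE; left; exists w.
      by move=> [v _ e]; exists v => //=; rewrite e to_real4K.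
    have : range h (to_real4 (graph2 R w)) by rewrite hE; right; exists w.
    by move=> [v _ e]; exists v => //=; rewrite e to_real4K.
  move=> [v _ <-].
  have : (range (to_real4 \o @graph1 R) `|` range (to_real4 \o @graph2 R)) (h v)
    by rewrite -hE; exists v.
  by case=> -[w _ e]; [left|right]; exists w => //=; rewrite -e /= to_real4K.
apply: (embedded_Cantor R row_hausdorff).
  by move=> w; exact: (@continuous_comp _ _ _ h of_real4 w (ch w) (@of_real4_cont _)).
exact: (inj_comp (can_inj of_real4K) hi).
Qed.
End CantorSets.

Theorem theorem3p11 (R : realType) :
  exists X : set 'rV[R[i]]_2,
    [/\ is_Cantor_set R X,
        nontrivial_rational_hull X &
        exists X1 X2 : set 'rV[R[i]]_2,
          [/\ is_Cantor_set R X1 /\ polynomially_convex X1,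
              is_Cantor_set R X2 /\ polynomially_convex X2 &
              X = X1 `|` X2]].
Proof.
exists (@graphs R); split; first exact: graphs_Cantor.
  exists 0; split; first exact: zero_in_rational_hull.
  case=> -[w _ /matrixP e].
    by have /eqP := e 0 0; rewrite pt20 mxE; apply/negP; exact: Psi_neq0.
  by have /eqP := e 0 1; rewrite pt21 mxE; apply/negP; exact: Psi_neq0.
exists (range (@graph1 R)), (range (@graph2 R)); split => //; split.
- apply: embedded_Cantor; [exact: row_hausdorff|exact: graph1_cont|exact: graph1_inj].
- exact: graph1_convex.
- apply: embedded_Cantor; [exact: row_hausdorff|exact: graph2_cont|exact: graph2_inj].
- exact: graph2_convex.
Qed.
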